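(* Let $\mathfrak s$ be a symmetry jet on the manifold $M$. Then the curvature tensor $R$ of the associated affine connection $\nabla^{\mathfrak s}$ admits the expression $$R(X_x,Y_x)Z_x=\tfrac14\,\Pi\Bigl(\kappa(j^1_x\mathfrak s)\cdot j^1_x\mathfrak s\cdot\mathfrak X,\;\; j^1_x\mathfrak s\cdot\kappa(j^1_x\mathfrak s)\cdot\mathfrak X\Bigr),$$ where $x\in M$, $X,Y,Z$ are vector fields on $M$ and $\mathfrak X=Z_{**_{Y_x}}Y_{*_x}X_x\in T^3M$.
   Context: All objects are smooth. $\mathcal B^{(1)}$ is the Lie groupoid over $M$ of linear isomorphisms $\xi:T_xM\to T_yM$, source $\alpha(\xi)=x$, target $\beta(\xi)=y$; $-I_x=-\mathrm{id}_{T_xM}$. A local bisection of a Lie groupoid $G\rightrightarrows M$ is a section $b:U\to G$ of $\alpha$ over an open $U$ with $b^0:=\beta\circ b$ a diffeomorphism onto an open set; the $1$-jets $j^1_xb$ of local bisections of $G$ form again a Lie groupoid over $M$ ($\alpha(j^1_xb)=x$, $\beta(j^1_xb)=b^0(x)$, $j^1_{b^0(x)}b'\cdot j^1_xb=j^1_x(b'\cdot b)$). $\mathcal B^{(1,1)}_{nh}$ (resp. $\mathcal B^{(1,1,1)}_{nh}$) is the groupoid of $1$-jets of local bisections of $\mathcal B^{(1)}$ (resp. of $\mathcal B^{(1,1)}_{nh}$). For $j^1_xb\in\mathcal B^{(1,1)}_{nh}$, $p(j^1_xb)=b(x)$ and $p_*(j^1_xb)=(b^0)_{*_x}$; $\mathcal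 B^{(1,1)}_{sh}$ is the set of those with $p=p_*$. A symmetry jet is a smooth section $\mathfrak s:M\to\mathcal B^{(1,1)}_{sh}$ of $\alpha$ with $p(\mathfrak s(x))=-I_x$; it is a bisection of $\mathcal B^{(1,1)}_{nh}$, so $j^1_x\mathfrak s\in\mathcal B^{(1,1,1)}_{nh}$. With $(bY)_{b^0(x')}=b(x')Y_{x'}$, the associated connection is $(\nabla^{\mathfrak s}_XY)_x=\frac12[X,Y+s_xY]_x$ where $\mathfrak s(x)=j^1_xs_x$. Curvature: $R(X,Y)Z=\nabla_X\nabla_YZ-\nabla_Y\nabla_XZ-\nabla_{[X,Y]}Z$. Iterated tangent bundles: $T^kM=T(T^{k-1}M)$. $Y_*:TM\to T^2M$ is the differential of $Y:M\to TM$ and $Z_{**}:T^2M\to T^3M$ the second differential of $Z:M\to TM$. Actions: $j^1_xb\in\mathcal B^{(1,1)}_{nh}$ acts on $T^2M$ over $x$ by $j^1_xb\cdot\frac{dX_t}{dt}|_0=\frac{d}{dt}(b(x_t)X_t)|_0$ with $X_t\in T_{x_t}M$, $x_0=x$; and $j^1_xb\in\mathcal B^{(1,1,1)}_{nh}$ acts on $T^3M$ over $x$ by $j^1_xb\cdot\frac{d\mathcal Z_t}{dt}|_0=\frac{d}{dt}(b(x_t)\cdot\mathcal Z_t)|_0$, where $\mathcal Z_t\in T^2M$ lies over $x_t$. For any manifold $N$, the canonical involution of $T^2N$ is, in coordinates $(u,Q,R,W)$ induced by a chart of $N$ (vector with components $(R,W)$ at $(u,Q)\in TN$), the map $(u,Q,R,W)\mapsto(u,R,Q,W)$;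 $\kappa:T^3M\to T^3M$ denotes that of $T^2N$ with $N=TM$. The map $\kappa(j^1_x\mathfrak s):T^3_xM\to T^3_xM$ (where $T^3_xM$ is the part of $T^3M$ over $x$) is defined by $\kappa(j^1_x\mathfrak s)\cdot\mathfrak X=\kappa\bigl(j^1_x\mathfrak s\cdot\kappa(\mathfrak X)\bigr)$ (it need not come from a $(1,1,1)$-jet). $T^3M$ has three projections to $T^2M$: $p$, the canonical one; $p_*$, the differential of the canonical projection $T^2M\to TM$; $p_{**}$, the second differential of $TM\to M$. If two elements of $T^3M$ over $x$ have the same images under $p,p_*,p_{**}$, then in the coordinates of $T^3M$ induced by a chart of $M$ (obtained by iterating $TU\cong U\times\mathbb R^n$) they differ only in the last $n$ coordinates; $\Pi(\mathfrak X_1,\mathfrak X_2)\in T_xM$ is the (chart-independent) vector whose components are the difference (first minus second) of these last $n$ coordinates. The two elements appearing in the claim satisfy this condition. *)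

(* Defs.v *)
From HB Require Import structures.
From mathcomp Require Import all_boot all_order all_algebra.
From mathcomp Require Import all_classical all_reals all_analysis.

Set Implicit Arguments.
Unset Strict Implicit.
Unset Printing Implicit Defensive.

Import Order.TTheory GRing.Theory Num.Theory.
Import numFieldNormedType.Exports.

Local Open Scope classical_set_scope.
Local Open Scope ring_scope.

(* C^k on A.  Only used for A open in a finite-dimensional E, where asking every
   directional derivative x |-> 'd f x v to be C^k is the usual notion. *)
Fixpoint Ck (R : realType) (E F : normedModType R) (k : nat)
    (A : set E) (f : E -> F) : Prop :=
  match k with
  | 0%N => forall x, A x -> {for x, continuous f}
  | k'.+1 => (forall x, A x -> differentiable f x) /\
             (forall v : E, Ck k' A (fun x => 'd f x v))
  end.

Definition smooth_on (R : realType) (E F : normedModType R)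
  (A : set E) (f : E -> F) : Prop := forall k, Ck k A f.

(* cmap and cinv are total; they are meaningful on cdom and on the image of
   cdom respectively. *)
Record chart (R : realType) (E : normedModType R) (S : Type) := Chart {
  cdom : set S;
  cmap : S -> E;
  cinv : E -> S }.

(* A set with a preferred chart around each of its points.  This is the data
   (without axioms) from which the iterated tangent bundles are built. *)
Record charted (R : realType) (E : normedModType R) := Charted {
  point :> Type;
  chart_at : point -> chart E point }.

Record manifold (R : realType) (n : nat) := Manifold {
  mpoint : topologicalType;
  matlas : set (chart 'rV[R]_n mpoint);
  mchart_at : mpoint -> chart 'rV[R]_n mpoint;
  mhausdorff : hausdorff_space mpoint;
  msecond_countable : @second_countable mpoint;
  mchart_atlas : forall x, matlas (mchart_at x);
  mem_mchart : forall x, cdom (mchart_at x) x;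
  open_mdom : forall c, matlas c -> open (cdom c);
  open_mimage : forall c, matlas c -> open (cmap c @` cdom c);
  mchartK : forall c, matlas c -> forall x, cdom c x -> cinv c (cmap c x) = x;
  mchart_continuous : forall c, matlas c -> {within cdom c, continuous (cmap c)};
  mchart_inv_continuous : forall c, matlas c -> {within cmap c @` cdom c, continuous (cinv c)};
  mchart_smooth : forall c d, matlas c -> matlas d ->
        smooth_on (cmap c @` (cdom c `&` cdom d)) (cmap d \o cinv c) }.

Coercion charted_of (R : realType) (n : nat) (M : manifold R n) :
  charted 'rV[R]_n := Charted (@mchart_at R n M).

Definition mopen (R : realType) (n : nat) (M : manifold R n) (U : set M) :
  Prop := @open (mpoint M) U.

(* The tangent space at x is the model space: a tangent vector at x is recorded
   by its components in the preferred chart chart_at x. *)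
Definition tvec (R : realType) (E : normedModType R) (N : charted E) (x : N) :
  normedModType R := E.

(* components in the chart c of the tangent vector v at x *)
Definition comp_in (R : realType) (E : normedModType R) (N : charted E)
    (c : chart E N) (x : N) (v : tvec x) : E :=
  'd (cmap c \o cinv (chart_at x)) (cmap (chart_at x) x) v.

(* the tangent vector at x whose components in the chart c are w *)
Definition vec_of (R : realType) (E : normedModType R) (N : charted E)
    (c : chart E N) (x : N) (w : E) : tvec x :=
  'd (cmap (chart_at x) \o cinv c) (cmap c x) w.

(* the chart of TN induced by the chart c of N *)
Definition tchart (R : realType) (E : normedModType R) (N : charted E)
    (c : chart E N) : chart (E * E)%type (N * E)%type :=
  Chart [set X : N * E | cdom c X.1]
    (fun X => (cmap c X.1, comp_in c (X.2 : tvec X.1)))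
    (fun e => (cinv c e.1,
       'd (cmap (chart_at (cinv c e.1)) \o cinv c) (e.1) (e.2))).

Definition TB (R : realType) (E : normedModType R) (N : charted E) :
    charted (E * E)%type :=
  @Charted R (E * E)%type (N * E)%type (fun X => tchart (chart_at X.1)).

Definition tmap (R : realType) (E E' : normedModType R) (N : charted E)
    (N' : charted E') (F : N -> N') : TB N -> TB N' :=
  fun X => (F X.1,
    'd (cmap (chart_at (F X.1)) \o F \o cinv (chart_at X.1))
       (cmap (chart_at X.1) X.1) X.2).

Definition velocity (R : realType) (E : normedModType R) (N : charted E)
    (g : R -> N) (t : R) : TB N :=
  (g t, 'd (cmap (chart_at (g t)) \o g : R^o -> E) t 1).

Lemma near_eq_diff (R : realType) (V W : normedModType R) (f g : V -> W)
    (x : V) :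
  (\forall y \near x, f y = g y) -> differentiable f x ->
  'd g x = 'd f x :> (V -> W).
Proof.
move=> fg df.
have [dfc] := (diff_locallyP _ _).1 df.
move=> /eqaddoP fE; apply: diff_unique => //.
apply/eqaddoP => e e0; have := fE e e0.
have fg0 : \forall h \near (0 : V), f (h + x) = g (h + x).
  by move: fg; rewrite (near_shift 0 x) /=; apply: filterS => h /=; rewrite subr0.
have gx : f x = g x by exact: (nbhs_singleton fg).
apply: filter_app; apply: filterS fg0 => h /= hE.
by rewrite !fctE /= -hE -gx.
Qed.

(* tmap F (dg/dt) = d(F g)/dt: actions given on velocities of curves by
   dX_t/dt |-> d(F X_t)/dt are the tangent maps of F. *)
Lemma tmap_velocity (R : realType) (E E' : normedModType R) (N : charted E)
    (N' : charted E') (F : N -> N') (g : R -> N) (t : R) :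
  (\forall u \near (t : R^o),
     cinv (chart_at (g t)) (cmap (chart_at (g t)) (g u)) = g u) ->
  differentiable (cmap (chart_at (g t)) \o g : R^o -> E) t ->
  differentiable (cmap (chart_at (F (g t))) \o F \o cinv (chart_at (g t)))
    (cmap (chart_at (g t)) (g t)) ->
  tmap F (velocity g t) = velocity (F \o g) t.
Proof.
move=> gE dg dF; rewrite /tmap /velocity /=; congr (_, _).
pose h : R^o -> E := cmap (chart_at (g t)) \o g.
pose G : E -> E' := cmap (chart_at (F (g t))) \o F \o cinv (chart_at (g t)).
have -> : 'd G (h t) ('d h t 1) = 'd (G \o h) (t : R^o) 1.
  by rewrite diff_comp.
have GhE : \forall u \near (t : R^o),
    (G \o h) u = (cmap (chart_at (F (g t))) \o (F \o g)) u.
  by apply: filterS gE => u gu; rewrite /G /h /= gu.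
have dGh : differentiable (G \o h) (t : R^o) by exact: differentiable_comp.
exact: (congr1 (fun k : R^o -> E' => k 1) (esym (near_eq_diff GhE dGh))).
Qed.

Definition smooth_at (R : realType) (E E' : normedModType R) (N : charted E)
    (N' : charted E') (F : N -> N') (x : N) : Prop :=
  let c := chart_at x in let d := chart_at (F x) in
  exists V : set E,
    [/\ open V, V (cmap c x), V `<=` cmap c @` cdom c,
        forall e, V e -> cdom d (F (cinv c e)) &
        smooth_on V (cmap d \o F \o cinv c)].

Record vector_field (R : realType) (n : nat) (M : manifold R n) :=
  VectorField {
    vf :> forall x : M, tvec x;
    vf_smooth : forall x : M, @smooth_at R _ _ M (TB M) (fun y => (y, vf y)) x }.

(* The canonical involution of T(TN). *)
Definition kappa (R : realType) (E : normedModType R) (N : charted E)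
    (W : TB (TB N)) : TB (TB N) :=
  let c := tchart (N := TB N) (tchart (chart_at W.1.1)) in
  let e := cmap c W in
  cinv c ((e.1.1, e.2.1), (e.1.2, e.2.2)).

(* A groupoid over M, of which only the alpha-fibres, the target map and the
   smooth structure are recorded.  If c, d are charts of M around x and around
   tgt g, the coordinates of g in the fibre over x are
   (cmap c x, cmap d (tgt g), fcoord c d g). *)
Record gpd (R : realType) (n : nat) (M : manifold R n) := Gpd {
  fib : M -> Type;
  tgt : forall x, fib x -> M;
  fdim : nat;
  fcoord : chart 'rV[R]_n M -> chart 'rV[R]_n M ->
           forall x, fib x -> 'rV[R]_fdim }.
Arguments tgt {R n M} G {x} : rename.
Arguments fcoord {R n M} G c d {x} : rename.

Definition gsection (R : realType) (n : nat) (M : manifold R n) (G : gpd M) :=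
  forall x : M, fib G x.

Definition base_map (R : realType) (n : nat) (M : manifold R n) (G : gpd M)
    (b : gsection G) : M -> M := fun x => tgt G (b x).

Definition sect_coord (R : realType) (n : nat) (M : manifold R n) (G : gpd M)
    (b : gsection G) (c d : chart 'rV[R]_n M) (e : 'rV[R]_n) :
    'rV[R]_(n + fdim G) :=
  row_mx (cmap d (base_map b (cinv c e))) (fcoord G c d (b (cinv c e))).

Definition smooth_section_at (R : realType) (n : nat) (M : manifold R n)
    (G : gpd M) (b : gsection G) (x : M) : Prop :=
  let c := chart_at x in let d := chart_at (base_map b x) in
  exists V : set 'rV[R]_n,
    [/\ open V, V (cmap c x), V `<=` cmap c @` cdom c,
        forall e, V e -> cdom d (base_map b (cinv c e)) &
        smooth_on V (sect_coord b c d)].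

(* The section is given by a total function whose values outside U are
   irrelevant. *)
Definition local_bisection (R : realType) (n : nat) (M : manifold R n)
    (G : gpd M) (U : set M) (b : gsection G) : Prop :=
  [/\ mopen U,
      forall x, U x -> smooth_section_at b x,
      mopen (base_map b @` U) &
      exists g : M -> M, (forall x, U x -> g (base_map b x) = x) /\
        (forall y, (base_map b @` U) y -> smooth_at g y)].

Record bisection (R : realType) (n : nat) (M : manifold R n) (G : gpd M) :=
  Bisection {
    bdom : set M;
    bsec :> forall x : M, fib G x;
    bisectionP : local_bisection bdom bsec }.

Definition same_jet (R : realType) (n : nat) (M : manifold R n) (G : gpd M)
    (x : M) (b b' : bisection G) : Prop :=
  let c := chart_at x in let d := chart_at (base_map b x) in
  b x = b' x /\
  'J (sect_coord b c d) (cmap c x) = 'J (sect_coord b' c d) (cmap c x).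

Definition jet_class (R : realType) (n : nat) (M : manifold R n) (G : gpd M)
    (x : M) (b : bisection G) : set (bisection G) :=
  [set b' | bdom b' x /\ same_jet x b b'].

Record jet (R : realType) (n : nat) (M : manifold R n) (G : gpd M) (x : M) :=
  Jet {
    jclass : set (bisection G);
    jclassP : exists b, bdom b x /\ jclass = jet_class x b }.

Definition jet_of (R : realType) (n : nat) (M : manifold R n) (G : gpd M)
    (b : bisection G) (x : M) (bx : bdom b x) : jet G x :=
  Jet (ex_intro (fun b' => bdom b' x /\ jet_class x b = jet_class x b')
         b (conj bx erefl)).

Definition jrep (R : realType) (n : nat) (M : manifold R n) (G : gpd M)
    (x : M) (j : jet G x) : bisection G := projT1 (cid (jclassP j)).

(* The groupoid of 1-jets of local bisections of G. *)
Definition J1 (R : realType) (n : nat) (M : manifold R n) (G : gpd M) :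
    gpd M :=
  @Gpd R n M (jet G) (fun x j => base_map (jrep j) x)
    (fdim G + n * (n + fdim G))%N
    (fun c d x j => row_mx (fcoord G c d (jrep j x))
       (mxvec ('J (sect_coord (jrep j) c d) (cmap c x)))).

Record tiso (R : realType) (n : nat) (M : manifold R n) (x : M) := TIso {
  itgt : M;
  imap :> tvec x -> tvec itgt;
  imap_linear : linear imap;
  imap_bijective : bijective imap }.

Definition B1 (R : realType) (n : nat) (M : manifold R n) : gpd M :=
  @Gpd R n M (@tiso R n M) (@itgt R n M) (n * n)%N
    (fun c d x xi =>
       mxvec (lin1_mx (fun w => comp_in d (xi (vec_of c x w))))).

Definition B11 (R : realType) (n : nat) (M : manifold R n) : gpd M :=
  J1 (B1 M).

Definition B111 (R : realType) (n : nat) (M : manifold R n) : gpd M :=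
  J1 (B11 M).

Definition jet_p (R : realType) (n : nat) (M : manifold R n) (x : M)
    (j : fib (B11 M) x) : fib (B1 M) x := jrep j x.

Definition jet_pstar (R : realType) (n : nat) (M : manifold R n) (x : M)
    (j : fib (B11 M) x) (v : tvec x) : tvec (tgt (B11 M) j) :=
  (tmap (base_map (jrep j)) ((x, v) : TB M)).2.

Definition semiholonomic (R : realType) (n : nat) (M : manifold R n) (x : M)
    (j : fib (B11 M) x) : Prop :=
  forall v : tvec x, jet_p j v = jet_pstar j v.

Lemma opp_linear (R : realType) (n : nat) (M : manifold R n) (x : M) :
  linear (fun v : tvec x => - v).
Proof. by move=> a u v; rewrite opprD scalerN. Qed.

Lemma opp_bijective (R : realType) (n : nat) (M : manifold R n) (x : M) :
  bijective (fun v : tvec x => - v).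
Proof. by exists (fun v : tvec x => - v) => v; rewrite opprK. Qed.

Definition minus_id (R : realType) (n : nat) (M : manifold R n) (x : M) :
    fib (B1 M) x :=
  @TIso R n M x x (fun v => - v) (@opp_linear R n M x) (@opp_bijective R n M x).

Record symmetry_jet (R : realType) (n : nat) (M : manifold R n) :=
  SymmetryJet {
    sj :> forall x : M, fib (B11 M) x;
    sj_smooth : forall x, smooth_section_at sj x;
    sj_semiholonomic : forall x, semiholonomic (sj x);
    sj_p : forall x, jet_p (sj x) = minus_id x }.

Lemma symmetry_jet_bisection (R : realType) (n : nat) (M : manifold R n)
    (s : symmetry_jet M) : local_bisection setT s.
Proof.
have sid : base_map (G := B11 M) s = id.
  apply/funext => x.
  by rewrite -[RHS]/(tgt (B1 M) (minus_id x)) -(sj_p s x).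
split.
- exact: openT.
- by move=> x _; exact: sj_smooth.
- by rewrite sid image_id; exact: openT.
- exists id; split=> [x _|y _]; first by rewrite sid.
  have yA : matlas (mchart_at y) by exact: mchart_atlas.
  exists (cmap (mchart_at y) @` (cdom (mchart_at y) `&` cdom (mchart_at y))).
  split.
  + by rewrite setIid; apply: open_mimage.
  + by exists y => //; split; apply: mem_mchart.
  + by rewrite setIid.
  + by (move=> _ [z [zd _] <-] /=; rewrite (mchartK yA)).
  + exact: mchart_smooth.
Qed.

Definition sj_bisection (R : realType) (n : nat) (M : manifold R n)
    (s : symmetry_jet M) : bisection (B11 M) :=
  Bisection (symmetry_jet_bisection s).

Definition j1s (R : realType) (n : nat) (M : manifold R n)
    (s : symmetry_jet M) (x : M) : fib (B111 M) x :=
  @jet_of R n M (B11 M) (sj_bisection s) x I.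

Definition act_B1 (R : realType) (n : nat) (M : manifold R n)
    (b : gsection (B1 M)) : TB M -> TB M :=
  fun X => (base_map b X.1, b X.1 X.2).

Definition act_B11 (R : realType) (n : nat) (M : manifold R n) (x : M)
    (j : fib (B11 M) x) : TB (TB M) -> TB (TB M) :=
  tmap (act_B1 (jrep j)).

(* (x', Z) |-> b(x') . Z for Z in T^2 M over x' *)
Definition act_sec_B11 (R : realType) (n : nat) (M : manifold R n)
    (b : gsection (B11 M)) : TB (TB M) -> TB (TB M) :=
  fun Z => act_B11 (b Z.1.1) Z.

Definition act_B111 (R : realType) (n : nat) (M : manifold R n) (x : M)
    (j : fib (B111 M) x) : TB (TB (TB M)) -> TB (TB (TB M)) :=
  tmap (act_sec_B11 (jrep j)).

Definition kappa_act (R : realType) (n : nat) (M : manifold R n) (x : M)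
    (j : fib (B111 M) x) (W : TB (TB (TB M))) : TB (TB (TB M)) :=
  kappa (N := TB M) (act_B111 j (kappa (N := TB M) W)).

(* Vector fields without smoothness requirement; the vector fields b Y below
   are only defined near a point and are extended by 0. *)
Definition vfield (R : realType) (n : nat) (M : manifold R n) :=
  forall x : M, tvec x.

Definition vf_coord (R : realType) (n : nat) (M : manifold R n)
    (X : vfield M) (c : chart 'rV[R]_n M) (e : 'rV[R]_n) : 'rV[R]_n :=
  comp_in c (X (cinv c e)).

Definition lie (R : realType) (n : nat) (M : manifold R n) (X Y : vfield M) :
    vfield M :=
  fun x => let c := chart_at x in let e := cmap c x in
    'd (vf_coord Y c) e (vf_coord X c e) - 'd (vf_coord X c) e (vf_coord Y c e).

(* (b Y)_(b^0 x') = b(x') Y_x' for x' in the domain of b *)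
Definition push (R : realType) (n : nat) (M : manifold R n)
    (b : bisection (B1 M)) (Y : vfield M) : vfield M :=
  fun y =>
    match pselect (exists x', bdom b x' /\ base_map b x' = y) with
    | left h => let x' := projT1 (cid h) in b x' (Y x')
    | right _ => 0
    end.

Definition nabla (R : realType) (n : nat) (M : manifold R n)
    (s : symmetry_jet M) (X Y : vfield M) : vfield M :=
  fun x => 2^-1 *: lie X (fun y => Y y + push (jrep (s x)) Y y) x.

Definition curvature (R : realType) (n : nat) (M : manifold R n)
    (s : symmetry_jet M) (X Y Z : vfield M) : vfield M :=
  fun x => nabla s X (nabla s Y Z) x - nabla s Y (nabla s X Z) x
           - nabla s (lie X Y) Z x.

Definition TBproj (R : realType) (E : normedModType R) (N : charted E) :
  TB N -> N := fun X => X.1.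

Definition same_projections (R : realType) (n : nat) (M : manifold R n)
    (W1 W2 : TB (TB (TB M))) : Prop :=
  [/\ TBproj W1 = TBproj W2,
      tmap (@TBproj R _ (TB M)) W1 = tmap (@TBproj R _ (TB M)) W2 &
      tmap (tmap (@TBproj R _ M)) W1 = tmap (tmap (@TBproj R _ M)) W2].

(* Partial function, with value 0 outside its domain.  The difference is taken
   in the preferred chart around the base point x, so that it is the element
   of tvec x with these components. *)
Definition Pi (R : realType) (n : nat) (M : manifold R n)
    (W1 W2 : TB (TB (TB M))) : tvec W1.1.1.1 :=
  let c := tchart (N := TB (TB M)) (tchart (N := TB M)
             (tchart (chart_at W1.1.1.1))) in
  if pselect (same_projections W1 W2)
  then (cmap c W1).2.2.2 - (cmap c W2).2.2.2
  else 0.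

(* Main.v *)
Require Import Defs.
From HB Require Import structures.
From mathcomp Require Import all_boot all_order all_algebra.
From mathcomp Require Import all_classical all_reals all_analysis.
From mathcomp Require Import ring.
Import Order.TTheory GRing.Theory Num.Theory.
Import numFieldNormedType.Exports.
Local Open Scope ring_scope.

(** Work in the preferred chart c around x.  Near x the jet s(e) has base point
e, linear part -1 and, by semiholonomy, a base map with differential -1, so it
is described by the derivative of its linear part alone: a bilinear map
(v, w) |-> G_e(v, w) depending smoothly on e.  Both sides of the formula are
computed in terms of G, and compared.

Left-hand side.  The field Z + s_y Z vanishes at y, and for fields vanishing
at y the bracket [Y, Z + s_y Z]_y is just a derivative, which can be computed
in any chart ([lie_vanishing]).  The derivative of the pushed field is
v |-> DZ(v) - G(v, Z) ([is_diff_push_sj]): the sign of the linear part cancels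
the sign of the derivative of the inverse base map.  Hence, at every point near
x and in the single chart c, nabla_Y Z = DZ(Y) - 1/2 G(Y, Z)
([nabla_chart]); so G is -2 times the Christoffel symbols.  Differentiating
once more, the second derivatives of Z cancel by [schwarz], and
R(X, Y) Z = 1/2 (DG[Y](X, Z) - DG[X](Y, Z))
            + 1/4 (G(X, G(Y, Z)) - G(Y, G(X, Z)))    ([curvature_at]).

Right-hand side.  The jets s(e) act on T^2 M by
(e, Q, A, B) |-> (e, -Q, -A, G_e(A, Q) - B), and the 1-jet of s at x acts on
T^3 M by the tangent map of this ([act_B111_j1s]); kappa exchanges two of the
four components ([kappa_at]).  Composing in both orders gives elements with the
same first seven components whose last ones differ by
2 (DG[A](U, Q) - DG[U](A, Q)) + G(U, G(A, Q)) - G(A, G(U, Q))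
([Pi_commutator]).  Only Q, A and U enter, and for the element
Z_** Y_* X these are Z, Y and X ([tmap_vf], [tmap_tmap_vf]).

What has to be paid for is that tangent vectors at each point are recorded in a
preferred chart of that point, so that even the smoothness of
e |-> G_e concerns points whose preferred charts are unrelated.  The lemmas on
[compatible] families of charts transport derivatives, tangent maps
([tmap_chart]) and sections of groupoids ([section_diff_change]) to the
chart c. *)

Set Implicit Arguments.
Unset Strict Implicit.
Unset Printing Implicit Defensive.
Local Open Scope classical_set_scope.

(** * Fréchet derivatives of matrix-valued maps *)

Section Calculus.
Context {R : realType}.
Implicit Types V W : normedModType R.

Lemma is_diff_near_eq V W (f g df : V -> W) (x : V) :
  (\forall y \near x, f y = g y) -> is_diff x f df -> is_diff x g df.
Proof.
move=> fg dfx; have dE := near_eq_diff fg (ex_diff (is_diff_def := dfx)).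
have gE : 'd g x = df :> (V -> W) by rewrite dE; exact: diff_val.
split=> //; apply/diff_locallyP; rewrite dE; split; first exact: diff_continuous.
have [_] := (diff_locallyP _ _).1 (ex_diff (is_diff_def := dfx)).
move=> /eqaddoP fE; apply/eqaddoP => e e0; have := fE e e0.
have fg0 : \forall h \near (0 : V), f (h + x) = g (h + x).
  by move: fg; rewrite (near_shift 0 x) /=; apply: filterS => h /=; rewrite subr0.
have gx : f x = g x by exact: (nbhs_singleton fg).
apply: filter_app; apply: filterS fg0 => h /= hE.
by rewrite !fctE /= -hE -gx.
Qed.

Lemma is_diff_ext V W (f g df dg : V -> W) (x : V) :
  is_diff x f df -> f =1 g -> df =1 dg -> is_diff x g dg.
Proof. by move=> + /funext <- /funext <-. Qed.

Lemma is_diff_sum V W (I : finType) (f df : I -> V -> W) (x : V) :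
  (forall i, is_diff x (f i) (df i)) ->
  is_diff x (fun y => \sum_i f i y) (fun v => \sum_i df i v).
Proof.
move=> H.
elim: (index_enum I) => [|i r IH].
  by apply: (is_diff_ext (is_diff_cst 0 x)) => y; rewrite big_nil.
have := is_diffD (H i) IH.
move=> /is_diff_ext; apply=> y; by rewrite big_cons.
Qed.

Lemma is_diffZfun V W (k dk : V -> R) (w : W) (x : V) :
  is_diff x k dk -> is_diff x (fun y => k y *: w) (fun v => dk v *: w).
Proof.
move=> dkx; exact: (is_diff_comp dkx (is_diff_scalel (k x) w)).
Qed.

(** Stated entrywise because a product of matrices is differentiated through
    the product rule for real functions. *)
Lemma is_diff_mx V m n (f df : V -> 'M[R]_(m, n)) (x : V) :
  (forall i j, is_diff x (fun y => f y i j : R) (fun v => df v i j : R)) ->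
  is_diff x f df.
Proof.
move=> H.
have := @is_diff_sum V 'M[R]_(m, n) 'I_m _ _ x
  (fun i => @is_diff_sum V _ 'I_n _ _ x
    (fun j => is_diffZfun (delta_mx i j : 'M[R]_(m, n)) (H i j))).
by move=> /is_diff_ext; apply=> y; rewrite [RHS]matrix_sum_delta.
Qed.

Lemma is_diff_lin V W (L : V -> W) (x : V) :
  linear L -> continuous L -> is_diff x L L.
Proof.
move=> Llin Lc.
pose LL : {linear V -> W} := HB.pack L (GRing.isLinear.Build _ _ _ _ L Llin).
rewrite -[L]/(LL : V -> W).
by split; [exact: linear_differentiable|exact: diff_lin].
Qed.

Lemma is_diff_coord V m n (f df : V -> 'M[R]_(m, n)) (x : V) i j :
  is_diff x f df -> is_diff x (fun y => f y i j : R) (fun v => df v i j : R).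
Proof.
move=> dfx; pose C (A : 'M[R]_(m, n)) : R := A i j.
suff dC : is_diff (f x) C C by exact: (is_diff_comp dfx dC).
apply: is_diff_lin; last exact: coord_continuous.
by move=> a A B; rewrite /C !mxE.
Qed.

(** Every linear map on matrices is a finite combination of the coordinates,
    which are differentiable. *)
Lemma is_diff_linmx V W m n (L : 'M[R]_(m, n) -> W) (f df : V -> 'M[R]_(m, n))
    (x : V) : linear L -> is_diff x f df ->
  is_diff x (fun y => L (f y)) (fun v => L (df v)).
Proof.
move=> Llin dfx.
pose LL : {linear 'M[R]_(m, n) -> W} :=
  HB.pack L (GRing.isLinear.Build _ _ _ _ L Llin).
have LE A : L A = \sum_i \sum_j A i j *: L (delta_mx i j).
  rewrite -[L A]/(LL A) {1}(matrix_sum_delta A) linear_sum; apply: eq_bigr => i _.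
  by rewrite linear_sum; apply: eq_bigr => j _; rewrite linearZ.
have := @is_diff_sum V W 'I_m _ _ x
  (fun i => @is_diff_sum V _ 'I_n _ _ x
    (fun j => is_diffZfun (L (delta_mx i j)) (is_diff_coord i j dfx))).
by move=> /is_diff_ext; apply=> y; rewrite [RHS]LE.
Qed.

Lemma is_diff_mulmx V m n p (f df : V -> 'M[R]_(m, n))
    (g dg : V -> 'M[R]_(n, p)) (x : V) :
  is_diff x f df -> is_diff x g dg ->
  is_diff x (fun y => f y *m g y) (fun v => df v *m g x + f x *m dg v).
Proof.
move=> dfx dgx; apply: is_diff_mx => i k.
have := @is_diff_sum V R 'I_n _ _ x
  (fun j => is_diffM (is_diff_coord i j dfx) (is_diff_coord j k dgx)).
move=> /is_diff_ext; apply=> y; first by rewrite !mxE.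
rewrite !mxE -big_split; apply: eq_bigr => j _ /=.
by rewrite !fctE /= addrC; congr (_ + _); exact: mulrC.
Qed.

Lemma is_diff_vec_mx V m n (f df : V -> 'rV[R]_(m * n)) (x : V) :
  is_diff x f df -> is_diff x (fun y => vec_mx (f y)) (fun v => vec_mx (df v)).
Proof. by apply: is_diff_linmx => a u v; rewrite linearP. Qed.

Lemma is_diff_mxvec V m n (f df : V -> 'M[R]_(m, n)) (x : V) :
  is_diff x f df -> is_diff x (fun y => mxvec (f y)) (fun v => mxvec (df v)).
Proof. by apply: is_diff_linmx => a u v; rewrite linearP. Qed.

Lemma is_diff_lsubmx V m n1 n2 (f df : V -> 'M[R]_(m, n1 + n2)) (x : V) :
  is_diff x f df -> is_diff x (fun y => lsubmx (f y)) (fun v => lsubmx (df v)).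
Proof. by apply: is_diff_linmx => a u v; rewrite linearP. Qed.

Lemma is_diff_rsubmx V m n1 n2 (f df : V -> 'M[R]_(m, n1 + n2)) (x : V) :
  is_diff x f df -> is_diff x (fun y => rsubmx (f y)) (fun v => rsubmx (df v)).
Proof. by apply: is_diff_linmx => a u v; rewrite linearP. Qed.

Lemma is_diff_row_mx V m n1 n2 (f df : V -> 'M[R]_(m, n1))
    (g dg : V -> 'M[R]_(m, n2)) (x : V) :
  is_diff x f df -> is_diff x g dg ->
  is_diff x (fun y => row_mx (f y) (g y)) (fun v => row_mx (df v) (dg v)).
Proof.
move=> dfx dgx; apply: is_diff_mx => i j; rewrite -[j]splitK.
case: (fintype.split j) => k /=.
  by have := is_diff_coord i k dfx => /is_diff_ext; apply=> y; rewrite row_mxEl.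
by have := is_diff_coord i k dgx => /is_diff_ext; apply=> y; rewrite row_mxEr.
Qed.

Lemma is_diff_fst V W W' (f df : V -> W * W') (x : V) :
  is_diff x f df -> is_diff x (fun y => (f y).1) (fun v => (df v).1).
Proof.
move=> dfx; suff dp : is_diff (f x) fst fst by exact: (is_diff_comp dfx dp).
by apply: is_diff_lin => // y; exact: cvg_fst.
Qed.

Lemma is_diff_snd V W W' (f df : V -> W * W') (x : V) :
  is_diff x f df -> is_diff x (fun y => (f y).2) (fun v => (df v).2).
Proof.
move=> dfx; suff dp : is_diff (f x) snd snd by exact: (is_diff_comp dfx dp).
by apply: is_diff_lin => // y; exact: cvg_snd.
Qed.

Lemma is_diff_cont V W (f df : V -> W) (x : V) :
  is_diff x f df -> {for x, continuous f}.
Proof. by move=> dfx; apply: differentiable_continuous; apply: ex_diff. Qed.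

Lemma is_diff_near V W (f df : V -> W) (x : V) (P : W -> Prop) :
  is_diff x f df -> (\forall z \near f x, P z) -> \forall y \near x, P (f y).
Proof. by move=> dfx Pfx; exact: (is_diff_cont dfx Pfx). Qed.

Lemma diff_jacobian m n (f : 'rV[R]_m -> 'rV[R]_n) (x v : 'rV[R]_m) :
  'd f x v = v *m 'J f x.
Proof. by rewrite /jacobian mul_rV_lin1. Qed.

(** The joint regularity of (y, v) |-> 'd f y v: it is linear in v, so it
    reduces to the differentiability of the Jacobian matrix, whose rows are
    the directional derivatives along the standard basis. *)
Lemma is_diff_jacobian V m n (f : 'rV[R]_m -> 'rV[R]_n) (g dg : V -> 'rV[R]_m)
    (x : V) : is_diff x g dg ->
  (forall v, differentiable (fun y => 'd f y v) (g x)) ->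
  exists dJ, is_diff x (fun y => 'J f (g y)) dJ.
Proof.
move=> dgx H.
pose dJ v : 'M[R]_(m, n) :=
  \matrix_(i, j) ('d (fun y => 'd f y (delta_mx 0 i)) (g x) (dg v) 0 j).
exists dJ; apply: is_diff_mx => i j.
have := is_diff_coord 0 j (is_diff_comp dgx (differentiableP (H (delta_mx 0 i)))).
by move=> /is_diff_ext; apply=> y; rewrite !mxE.
Qed.

End Calculus.

(** * Symmetry of second derivatives *)

Section Schwarz.
Context {R : realType}.
Implicit Types V W : normedModType R.

Lemma diff_remainder V W (h : V -> W) (x : V) (e : R) :
  differentiable h x -> 0 < e ->
  \forall k \near (0 : V), `|h (k + x) - h x - 'd h x k| <= e * `|k|.
Proof.
move=> dh e0; have [_ /eqaddoP hE] := (diff_locallyP _ _).1 dh.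
have := hE e e0; apply: filterS => k /=.
by rewrite !fctE /= opprD addrA.
Qed.

(** The mean value theorem applied to s |-> f (x + s v + t w) - f (x + s v) on
    [0, t] turns the second difference into t times an increment of h = 'd f _
    v, and the differentiability of h at x alone estimates that increment up
    to o(t). *)
Lemma second_difference V (f : V -> R) (x v w : V) (e : R) :
  (\forall y \near x, differentiable f y) ->
  differentiable (fun y => 'd f y v : R) x -> 0 < e ->
  \forall t \near (0 : R)^'+,
    `|f (t *: v + t *: w + x) - f (t *: v + x) - f (t *: w + x) + f x
      - t ^+ 2 * 'd (fun y => 'd f y v : R) x w| <= e * t ^+ 2.
Proof.
move=> df dh e0.
set h := fun y => _ : R.
pose N := `|v| + `|w|.
have N0 : 0 <= N by rewrite addr_ge0.
(* the two increments have length at most t N; adding 1 keeps the quotient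
   defined when v = w = 0 *)
pose e' := e / (2 * N + 1).
have e'0 : 0 < e' by rewrite divr_gt0 // ltr_wpDl // mulr_ge0.
have dfs : \forall k \near (0 : V), differentiable f (k + x).
  by move: df; rewrite (near_shift 0 x) /=; apply: filterS => k /=; rewrite subr0.
have : \forall k \near (0 : V), differentiable f (k + x) /\
    `|h (k + x) - h x - 'd h x k| <= e' * `|k|.
  by near=> k; split; near: k => //; exact: diff_remainder.
move=> /nbhs_ballP[d /= d0 dH].
have {}dH k : `|k| < d -> differentiable f (k + x) /\
    `|h (k + x) - h x - 'd h x k| <= e' * `|k|.
  by move=> kd; apply: dH; rewrite /= -ball_normE /= sub0r normrN.
near=> t.
have t0 : 0 < t by near: t; exact: nbhs_right_gt.
have tN : t * N < d.
  rewrite (@le_lt_trans _ _ (t * (N + 1))) // ?ler_pM2l // ?lerDl //.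
  rewrite -ltr_pdivlMr; last by rewrite ltr_wpDl.
  by near: t; apply: nbhs_right_lt; rewrite divr_gt0 // ltr_wpDl.
have small a b : 0 <= a <= t -> 0 <= b <= t -> `|a *: v + b *: w| <= t * N.
  move=> /andP[a0 at_] /andP[b0 bt].
  rewrite (le_trans (ler_normD _ _)) // !normrZ !ger0_norm // mulrDr.
  by rewrite lerD // ler_wpM2r.
pose phi s : R := f (s *: v + t *: w + x) - f (s *: v + 0 *: w + x).
have tt : 0 <= t <= t by rewrite lexx ltW.
have t00 : (0 : R) <= 0 <= t by rewrite lexx ltW.
have dphi s : 0 <= s <= t ->
    is_derive s 1 phi (h (s *: v + t *: w + x) - h (s *: v + 0 *: w + x)).
  move=> st.
  have aff b : is_diff (s : R^o) (fun r : R^o => r *: v + b *: w + x)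
      (fun r => r *: v).
    have := is_diffD (is_diffD (is_diff_scalel s v) (is_diff_cst (b *: w) s))
       (is_diff_cst x s).
    by move=> /is_diff_ext; apply=> r //=; rewrite !fctE /= !addr0.
  have comp b : 0 <= b <= t ->
      is_diff (s : R^o) (fun r : R^o => f (r *: v + b *: w + x) : R^o)
      (fun r => 'd f (s *: v + b *: w + x) (r *: v)).
    move=> bt; have [dfb _] := dH _ (le_lt_trans (small _ _ st bt) tN).
    exact: (is_diff_comp (aff b) (differentiableP dfb)).
  have dd := is_diffB (comp t tt) (comp 0 t00).
  split; first by apply: diff_derivable; apply: ex_diff.
  rewrite deriveE; last by apply: ex_diff.
  by rewrite (diff_val (is_diff_def := dd)) !fctE !scale1r.
have phic : {within `[0, t], continuous phi}.
  apply: derivable_within_continuous => s; rewrite in_itv /= => st.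
  by have [] := dphi s st.
have dphi' (s : R) : s \in `]0, t[%R ->
    is_derive s 1 phi (h (s *: v + t *: w + x) - h (s *: v + 0 *: w + x)).
  by rewrite in_itv /= => /andP[s0 st]; apply: dphi; rewrite !ltW.
have [c ct] := MVT t0 dphi' phic.
rewrite subr0 /phi !scale0r !addr0 !add0r => phiE.
have ct' : 0 <= c <= t by move: ct; rewrite in_itv /= => /andP[c0 ct]; rewrite !ltW.
have [_ r1] := dH _ (le_lt_trans (small _ _ ct' tt) tN).
have [_ r2] := dH _ (le_lt_trans (small _ _ ct' t00) tN).
move: r1 r2; set k1 := c *: v + t *: w; set k2 := c *: v + 0 *: w => r1 r2.
have k1N : `|k1| <= t * N := small _ _ ct' tt.
have k2N : `|k2| <= t * N := small _ _ ct' t00.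
have k12 : 'd h x k1 - 'd h x k2 = t * 'd h x w.
  rewrite -linearB /k1 /k2 scale0r addr0 addrAC subrr add0r linearZ //.
have {}phiE : f (t *: v + t *: w + x) - f (t *: v + x) - f (t *: w + x) + f x =
    (h (k1 + x) - h (k2 + x)) * t.
  by rewrite /k1 /k2 scale0r addr0 -phiE; ring.
rewrite phiE; set a1 := h (k1 + x) in r1 *; set a2 := h (k2 + x) in r2 *.
have -> : (a1 - a2) * t - t ^+ 2 * 'd h x w =
   t * ((a1 - h x - 'd h x k1) - (a2 - h x - 'd h x k2)).
  by rewrite -[t ^+ 2 * _]mulrA -k12; ring.
rewrite normrM ger0_norm ?(ltW t0) // expr2 mulrCA ler_pM2l //.
apply: (le_trans (ler_normB _ _)).
apply: (@le_trans _ _ (e' * (t * N) + e' * (t * N))).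
  by apply: lerD; [apply: le_trans r1 _|apply: le_trans r2 _]; rewrite ler_pM2l.
have -> : e' * (t * N) + e' * (t * N) = (e' * (2 * N)) * t by ring.
rewrite ler_pM2r // /e' mulrAC ler_pdivrMr ?ltr_wpDl ?mulr_ge0 //.
by rewrite ler_pM2l // lerDl.
Unshelve. all: by end_near. Qed.

(** The second difference is symmetric in v and w. *)
Lemma schwarz_scalar V (f : V -> R) (x v w : V) :
  (\forall y \near x, differentiable f y) ->
  differentiable (fun y => 'd f y v : R) x ->
  differentiable (fun y => 'd f y w : R) x ->
  'd (fun y => 'd f y v : R) x w = 'd (fun y => 'd f y w : R) x v.
Proof.
move=> df dv dw; apply/eqP; rewrite -subr_eq0 -normr_le0.
apply/ler_addgt0Pr => e e0; rewrite add0r.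
have e2 : 0 < e / 2 by rewrite divr_gt0.
have : \forall t \near (0 : R)^'+, `|'d (fun y => 'd f y v : R) x w -
    'd (fun y => 'd f y w : R) x v| <= e.
  near=> t.
  have t0 : 0 < t by near: t; exact: nbhs_right_gt.
  have H1 : `|f (t *: v + t *: w + x) - f (t *: v + x) - f (t *: w + x) + f x
      - t ^+ 2 * 'd (fun y => 'd f y v : R) x w| <= e / 2 * t ^+ 2.
    by near: t; exact: second_difference.
  have H2 : `|f (t *: w + t *: v + x) - f (t *: w + x) - f (t *: v + x) + f x
      - t ^+ 2 * 'd (fun y => 'd f y w : R) x v| <= e / 2 * t ^+ 2.
    by near: t; exact: second_difference.
  rewrite [t *: w + t *: v]addrC in H2.
  rewrite -(@ler_pM2l _ (t ^+ 2)) ?exprn_gt0 //.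
  rewrite -[X in X * `|_|]ger0_norm ?sqr_ge0 // -normrM.
  move: H1 H2; set a := f _; set b := f _; set c := f _; set d := f x.
  set p := 'd _ _ _; set q := 'd _ _ _ => H1 H2.
  have -> : t ^+ 2 * (p - q) =
    (a - c - b + d - t ^+ 2 * q) - (a - b - c + d - t ^+ 2 * p) by ring.
  apply: (le_trans (ler_normB _ _)); apply: (le_trans (lerD H2 H1)).
  by rewrite -mulrDl -splitr mulrC.
by move=> /(@filter_ex _ _ _)[].
Unshelve. all: by end_near. Qed.

Lemma schwarz V m (f : V -> 'rV[R]_m) (x v w : V) :
  (\forall y \near x, differentiable f y) ->
  differentiable (fun y => 'd f y v) x ->
  differentiable (fun y => 'd f y w) x ->
  'd (fun y => 'd f y v) x w = 'd (fun y => 'd f y w) x v.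
Proof.
move=> df dv dw; apply/rowP => j.
have dfj y : differentiable f y ->
    is_diff y (fun z => f z 0 j : R) (fun u => 'd f y u 0 j).
  by move=> /differentiableP; exact: is_diff_coord.
have dd u : differentiable (fun y => 'd f y u) x ->
    is_diff x (fun y => 'd (fun z => f z 0 j : R) y u : R)
      (fun u' => 'd (fun y => 'd f y u) x u' 0 j).
  move=> /differentiableP du; apply: is_diff_near_eq (is_diff_coord 0 j du).
  apply: filterS df => y /dfj dy.
  by rewrite (diff_val (is_diff_def := dy)).
rewrite -[LHS](congr1 (fun k => k w) (diff_val (is_diff_def := dd _ dv))).
rewrite -[RHS](congr1 (fun k => k v) (diff_val (is_diff_def := dd _ dw))).
apply: schwarz_scalar.
- by apply: filterS df => y /dfj dy; apply: ex_diff.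
- by have ddv := dd _ dv; apply: ex_diff.
- by have ddw := dd _ dw; apply: ex_diff.
Qed.

End Schwarz.

(** * Charts and tangent maps *)

(** The axioms of an atlas that make sense without a topology on N, so that
    they can be stated for the charts of TB N as well. The last one replaces
    the openness of the overlap of two charts. *)
Record compatible (R : realType) (E : normedModType R) (N : charted E)
    (A : set (chart E N)) : Prop := Compatible {
  chart_at_in : forall p : N, A (chart_at p);
  mem_chart_at : forall p : N, cdom (chart_at p) p;
  cmapK : forall c p, A c -> cdom c p -> cinv c (cmap c p) = p;
  near_overlap : forall c d p, A c -> A d -> cdom c p -> cdom d p ->
    \forall e \near cmap c p,
      [/\ cdom c (cinv c e), cdom d (cinv c e) & cmap c (cinv c e) = e] }.

Definition differentiable_transitions (R : realType) (E : normedModType R)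
    (N : charted E) (A : set (chart E N)) : Prop :=
  forall c d p, A c -> A d -> cdom c p -> cdom d p ->
    differentiable (cmap d \o cinv c) (cmap c p).

(** Differentiability of F at p seen in the charts c and d. The first clause
    stands for the continuity of F at p, N' having no topology. *)
Definition chart_diff (R : realType) (E E' : normedModType R) (N : charted E)
    (N' : charted E') (c : chart E N) (d : chart E' N') (F : N -> N') (p : N) :=
  (\forall e \near cmap c p, cdom d (F (cinv c e))) /\
  differentiable (cmap d \o F \o cinv c) (cmap c p).

Section Transitions.
Context {R : realType} {E : normedModType R} {N : charted E}.
Context {A : set (chart E N)} (CA : compatible A).
Implicit Types (c d b : chart E N) (p : N).

Lemma diff_transition_id c p (w : E) : A c -> cdom c p ->
  'd (cmap c \o cinv c) (cmap c p) w = w.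
Proof.
move=> Ac cp.
have H : is_diff (cmap c p) (cmap c \o cinv c) id.
  apply: is_diff_near_eq (is_diff_id _).
  by apply: filterS (near_overlap CA Ac Ac cp cp) => e [_ _] /= ->.
by rewrite (diff_val (is_diff_def := H)).
Qed.

(** Tangent vectors at p are recorded by their components in the preferred
    chart of p. *)
Lemma comp_in_chart_at p (v : tvec p) : comp_in (chart_at p) v = v.
Proof.
by apply: diff_transition_id; [exact: (chart_at_in CA)|exact: (mem_chart_at CA)].
Qed.

Lemma tchart_chart_at (X : TB N) (p : N) : X.1 = p ->
  cmap (tchart (chart_at p)) X = (cmap (chart_at p) p, X.2).
Proof.
by case: X => q v /= ->; congr (_, _); exact: (@comp_in_chart_at p v).
Qed.

Lemma tchart_chart_at_inv p (v : E) :
  cinv (tchart (chart_at p)) (cmap (chart_at p) p, v) = (p, v).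
Proof.
rewrite /= (cmapK CA (chart_at_in CA p) (mem_chart_at CA p)); congr (_, _).
by apply: diff_transition_id; [exact: (chart_at_in CA)|exact: (mem_chart_at CA)].
Qed.

Context (DA : differentiable_transitions A).

Lemma diff_transition_comp c d b p (w : E) :
  A c -> A d -> A b -> cdom c p -> cdom d p -> cdom b p ->
  'd (cmap b \o cinv d) (cmap d p) ('d (cmap d \o cinv c) (cmap c p) w) =
  'd (cmap b \o cinv c) (cmap c p) w.
Proof.
move=> Ac Ad Ab cp dp bp.
have d1 : is_diff (cmap c p) (cmap d \o cinv c) ('d (cmap d \o cinv c) (cmap c p)).
  by apply: differentiableP; exact: DA.
have d2 : is_diff ((cmap d \o cinv c) (cmap c p)) (cmap b \o cinv d)
   ('d (cmap b \o cinv d) (cmap d p)).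
  by rewrite /= (cmapK CA Ac cp); apply: differentiableP; exact: DA.
have nE : \forall e \near cmap c p,
    ((cmap b \o cinv d) \o (cmap d \o cinv c)) e = (cmap b \o cinv c) e.
  apply: filterS (near_overlap CA Ac Ad cp dp) => e [_ de] _ /=.
  by rewrite (cmapK CA Ad de).
have H := is_diff_near_eq nE (is_diff_comp d1 d2).
by rewrite (diff_val (is_diff_def := H)).
Qed.

Lemma comp_in_comp_in c d p (v : tvec p) :
  A c -> A d -> cdom c p -> cdom d p ->
  'd (cmap d \o cinv c) (cmap c p) (comp_in c v) = comp_in d v.
Proof.
move=> Ac Ad cp dp; apply: diff_transition_comp => //.
  exact: (chart_at_in CA).
exact: (mem_chart_at CA).
Qed.

Lemma comp_in_vec_of c d p (w : E) : A c -> A d -> cdom c p -> cdom d p ->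
  comp_in d (vec_of c p w) = 'd (cmap d \o cinv c) (cmap c p) w.
Proof.
move=> Ac Ad cp dp; apply: diff_transition_comp => //.
  exact: (chart_at_in CA).
exact: (mem_chart_at CA).
Qed.

Lemma vec_ofK c p (w : E) : A c -> cdom c p -> comp_in c (vec_of c p w) = w.
Proof. by move=> Ac cp; rewrite comp_in_vec_of // diff_transition_id. Qed.

Lemma comp_inK c p (v : tvec p) : A c -> cdom c p ->
  vec_of c p (comp_in c v) = v.
Proof.
move=> Ac cp; rewrite -[RHS]comp_in_chart_at /vec_of comp_in_comp_in //.
  exact: (chart_at_in CA).
exact: (mem_chart_at CA).
Qed.

(** In the chart induced on TB N by c, the transition to the one induced by b
    is the transition of N on base points and its differential on vectors. *)
Lemma near_tchart c d (X : TB N) : A c -> A d -> cdom c X.1 -> cdom d X.1 ->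
  \forall e \near cmap (tchart c) X,
   [/\ cdom c (cinv c e.1), cdom d (cinv c e.1), cmap c (cinv c e.1) = e.1 &
    forall b, A b -> cdom b (cinv c e.1) ->
    cmap (tchart b) (cinv (tchart c) e) =
      (cmap b (cinv c e.1), 'd (cmap b \o cinv c) (e.1 : E) (e.2 : E))].
Proof.
move=> Ac Ad cX dX.
have H : \forall e \near cmap (tchart c) X, [/\ cdom c (cinv c e.1),
    cdom d (cinv c e.1) & cmap c (cinv c e.1) = e.1].
  exact: (is_diff_near (is_diff_fst (is_diff_id (cmap (tchart c) X)))
    (near_overlap CA Ac Ad cX dX)).
apply: filterS H => e /= [ce de eE]; split => // b Ab be.
congr (_, _).
by have := comp_in_vec_of e.2 Ac Ab ce be; rewrite /vec_of eE.
Qed.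

Lemma compatible_TB : @compatible R _ (TB N) (@tchart R E N @` A).
Proof.
split.
- by move=> p; exists (chart_at p.1) => //; exact: (chart_at_in CA).
- by move=> p; exact: (mem_chart_at CA).
- move=> _ [x v] [c Ac <-] /= cx; rewrite (cmapK CA Ac cx); congr (_, _).
  exact: (comp_inK v).
- move=> _ _ X [c Ac <-] [d Ad <-] cX dX.
  apply: filterS (near_tchart Ac Ad cX dX) => -[e w] [ce de eE /(_ c Ac ce) H].
  split => //; rewrite H eE; congr (_, _).
  by have := diff_transition_id w Ac ce; rewrite eE.
Qed.

(** One derivative is lost: transitions of TB N involve the differentials of
    those of N. *)
Lemma differentiable_transitions_TB :
  (forall c d p (w : E), A c -> A d -> cdom c p -> cdom d p ->
    differentiable (fun z : E * E => 'd (cmap d \o cinv c) (z.1 : E) (z.2 : E))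
      (cmap c p, w)) ->
  @differentiable_transitions R _ (TB N) (@tchart R E N @` A).
Proof.
move=> H _ _ X [c Ac <-] [d Ad <-] cX dX.
have di := is_diff_fst (is_diff_id (cmap (tchart c) X)).
have dfst := is_diff_comp di (differentiableP (DA Ac Ad cX dX)).
have dsnd := differentiableP
  (H c d X.1 (comp_in c (X.2 : tvec X.1)) Ac Ad cX dX).
have dp := is_diff_pair dfst dsnd.
have nE : \forall e \near cmap (tchart c) X,
   ((cmap d \o cinv c) e.1, 'd (cmap d \o cinv c) (e.1 : E) (e.2 : E)) =
   (cmap (tchart d) \o cinv (tchart c)) e.
  apply: filterS (near_tchart Ac Ad cX dX) => e [ce de eE /(_ d Ad de) H'].
  by rewrite [RHS]/comp H'.
exact: (ex_diff (is_diff_def := is_diff_near_eq nE dp)).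
Qed.

End Transitions.

Section Maps.
Context {R : realType} {E E' : normedModType R} {N : charted E} {N' : charted E'}.
Context {A : set (chart E N)} (CA : compatible A)
  (DA : differentiable_transitions A).
Context {A' : set (chart E' N')} (CA' : compatible A')
  (DA' : differentiable_transitions A').

Lemma chart_diff_mem (c : chart E N) (d : chart E' N') F p : A c -> cdom c p ->
  chart_diff c d F p -> cdom d (F p).
Proof. by move=> Ac cp [/nbhs_singleton]; rewrite (cmapK CA Ac cp). Qed.

(** Around p, F in the new charts is the composite of F in the old charts with
    two transition maps. *)
Lemma chart_diff_change (c c' : chart E N) (d d' : chart E' N') F p :
  A c -> A c' -> A' d -> A' d' -> cdom c p -> cdom c' p -> cdom d (F p) ->
  chart_diff c' d' F p ->
  chart_diff c d F p /\ forall w,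
  'd (cmap d \o F \o cinv c) (cmap c p) w =
  'd (cmap d \o cinv d') (cmap d' (F p))
    ('d (cmap d' \o F \o cinv c') (cmap c' p)
       ('d (cmap c' \o cinv c) (cmap c p) w)).
Proof.
move=> Ac Ac' Ad Ad' cp c'p dp [Fd' Fdiff].
have d'p : cdom d' (F p) by have := nbhs_singleton Fd'; rewrite (cmapK CA Ac' c'p).
have d1 := differentiableP (DA Ac Ac' cp c'p).
have d2 : is_diff ((cmap c' \o cinv c) (cmap c p)) (cmap d' \o F \o cinv c')
    ('d (cmap d' \o F \o cinv c') (cmap c' p)).
  by rewrite /= (cmapK CA Ac cp); exact: differentiableP.
have d12 := is_diff_comp d1 d2.
have d3 : is_diff (((cmap d' \o F \o cinv c') \o (cmap c' \o cinv c)) (cmap c p))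
    (cmap d \o cinv d') ('d (cmap d \o cinv d') (cmap d' (F p))).
  rewrite /= (cmapK CA Ac cp) (cmapK CA Ac' c'p).
  by apply: differentiableP; exact: DA'.
have near1 : \forall e \near cmap c p, [/\ cdom c' (cinv c e),
    cdom d' (F (cinv c e)) & cdom d (F (cinv c e))].
  have n1 : \forall e \near cmap c p, cdom d' (F (cinv c' (cmap c' (cinv c e)))).
    apply: (is_diff_near (P := fun z => cdom d' (F (cinv c' z))) d1).
    by rewrite /= (cmapK CA Ac cp).
  have n2 : \forall e \near cmap c p, cdom d
      (cinv d' (cmap d' (F (cinv c' (cmap c' (cinv c e)))))).
    apply: (is_diff_near (P := fun z => cdom d (cinv d' z)) d12).
    rewrite /= (cmapK CA Ac cp) (cmapK CA Ac' c'p).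
    by apply: filterS (near_overlap CA' Ad' Ad d'p dp) => z [].
  near=> e.
  have [_ c'e _] : [/\ cdom c (cinv c e), cdom c' (cinv c e) &
    cmap c (cinv c e) = e] by near: e; exact: (near_overlap CA).
  have d'e : cdom d' (F (cinv c e)).
    by rewrite -(cmapK CA Ac' c'e); near: e.
  split=> //; rewrite -(cmapK CA' Ad' d'e) -[X in F X](cmapK CA Ac' c'e).
  by near: e.
have nE : \forall e \near cmap c p,
    ((cmap d \o cinv d') \o ((cmap d' \o F \o cinv c') \o (cmap c' \o cinv c))) e =
    (cmap d \o F \o cinv c) e.
  apply: filterS near1 => e [c'e d'e _] /=.
  by rewrite (cmapK CA Ac' c'e) (cmapK CA' Ad' d'e).
have dF := is_diff_near_eq nE (is_diff_comp d12 d3).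
split; last by move=> w; rewrite (diff_val (is_diff_def := dF)).
by split; [apply: filterS near1 => e []|apply: ex_diff].
Unshelve. all: by end_near. Qed.

(** A tangent map is defined in the preferred charts of the point and of its
    image; by the chain rule it has the same expression in all charts. *)
Lemma tmap_chart (c : chart E N) (d : chart E' N') F (X : TB N) :
  A c -> A' d -> cdom c X.1 -> chart_diff c d F X.1 ->
  cmap (tchart d) (tmap F X) =
  (cmap d (F X.1),
   'd (cmap d \o F \o cinv c) (cmap c X.1) (comp_in c (X.2 : tvec X.1))).
Proof.
move=> Ac Ad cX Fcd; have dX := chart_diff_mem Ac cX Fcd.
have [_ dF] := chart_diff_change (chart_at_in CA X.1) Ac
  (chart_at_in CA' (F X.1)) Ad (mem_chart_at CA X.1) cX (mem_chart_at CA' _) Fcd.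
congr (_, _); rewrite /comp_in /tmap /= dF.
have atF := mem_chart_at CA' (F X.1).
rewrite (diff_transition_comp CA' DA') //; last exact: (chart_at_in CA').
by rewrite (diff_transition_id CA').
Qed.

End Maps.

(** * Charts of a manifold and its tangent bundles *)

Section Smooth.
Context {R : realType} {E F : normedModType R}.

Lemma smooth_on_diff (A : set E) (f : E -> F) (x : E) :
  smooth_on A f -> A x -> differentiable f x.
Proof. by move=> /(_ 1%N)[H _]; exact: H. Qed.

Lemma smooth_on_diff2 (A : set E) (f : E -> F) (x v : E) :
  smooth_on A f -> A x -> differentiable (fun y => 'd f y v) x.
Proof. by move=> /(_ 2%N)[_ /(_ v)[H _]]; exact: H. Qed.

End Smooth.

Section ManifoldCharts.
Context {R : realType} {n : nat} (M : manifold R n).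
Notation V := 'rV[R]_n.
Implicit Types (c d b : chart V M) (p x y : M).

(** The images of charts are open and their inverses are continuous. *)
Lemma near_cinv c p (O : set M) : matlas c -> cdom c p -> mopen O -> O p ->
  \forall e \near cmap c p, O (cinv c e).
Proof.
move=> Ac cp oO Op.
have ic : (cmap c @` cdom c) (cmap c p) by exists p.
have oi : open (cmap c @` cdom c) := open_mimage Ac.
have := mchart_inv_continuous Ac.
rewrite (continuous_open_subspace _ oi) => /(_ (cmap c p)).
rewrite inE => /(_ ic); apply.
by rewrite (mchartK Ac cp); exact: open_nbhs_nbhs.
Qed.

Lemma compatible_manifold : @compatible R V M (@matlas R n M).
Proof.
split.
- by move=> p; exact: mchart_atlas.
- by move=> p; exact: mem_mchart.
- by move=> c p Ac cp; exact: mchartK.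
- move=> c d p Ac Ad cp dp.
  have nc := near_cinv Ac cp (open_mdom Ac) cp.
  have nd := near_cinv Ac cp (open_mdom Ad) dp.
  have oi : open (cmap c @` cdom c) := open_mimage Ac.
  have ni : \forall e \near cmap c p, (cmap c @` cdom c) e.
    by apply: open_nbhs_nbhs; split => //; exists p.
  near=> e; split; [by near: e|by near: e|].
  have [q cq <-] : (cmap c @` cdom c) e by near: e.
  by rewrite (mchartK Ac cq).
Unshelve. all: by end_near. Qed.

Local Notation CM := compatible_manifold.

Lemma differentiable_transitions_manifold :
  @differentiable_transitions R V M (@matlas R n M).
Proof.
move=> c d p Ac Ad cp dp; apply: smooth_on_diff (mchart_smooth Ac Ad) _.
by exists p.
Qed.

Local Notation DM := differentiable_transitions_manifold.

Lemma diff_transition2 c d p v : matlas c -> matlas d -> cdom c p -> cdom d p ->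
  differentiable (fun e => 'd (cmap d \o cinv c) e v) (cmap c p).
Proof.
move=> Ac Ad cp dp; apply: smooth_on_diff2 (mchart_smooth Ac Ad) _.
by exists p.
Qed.

(** Here the second derivatives of the transitions of M are used, through
    their Jacobian matrices. *)
Lemma differentiable_transitions_TM :
  @differentiable_transitions R _ (TB M) (@tchart R V M @` @matlas R n M).
Proof.
apply: differentiable_transitions_TB CM DM _ => c d p w Ac Ad cp dp.
have d1 := is_diff_fst (is_diff_id ((cmap c p, w) : V * V)).
have d2 := is_diff_snd (is_diff_id ((cmap c p, w) : V * V)).
have [dJ dJx] := is_diff_jacobian d1 (fun v => diff_transition2 v Ac Ad cp dp).
have dm := is_diff_mulmx d2 dJx.
have nE : \forall z \near ((cmap c p, w) : V * V),
    z.2 *m 'J (cmap d \o cinv c) z.1 = 'd (cmap d \o cinv c) (z.1 : V) (z.2 : V).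
  by near=> z; rewrite diff_jacobian.
exact: (ex_diff (is_diff_def := is_diff_near_eq nE dm)).
Unshelve. all: by end_near. Qed.

Lemma compatible_TM :
  @compatible R _ (TB M) (@tchart R V M @` @matlas R n M).
Proof. exact: compatible_TB CM DM. Qed.

(** The preferred charts of the third tangent bundle only require the
    compatibility of the charts of the second one, for which the
    differentiability of the transitions of TM suffices. *)
Lemma compatible_TTM :
  @compatible R _ (TB (TB M))
    (@tchart R _ (TB M) @` (@tchart R V M @` @matlas R n M)).
Proof. exact: compatible_TB compatible_TM differentiable_transitions_TM. Qed.

End ManifoldCharts.

(** * Sections of the groupoid of linear isomorphisms *)

Section SectionsB1.
Context {R : realType} {n : nat} {M : manifold R n}.
Notation V := 'rV[R]_n.
Implicit Types (c d : chart V M) (p x y : M) (b : gsection (B1 M)).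
Local Notation CM := (compatible_manifold M).
Local Notation DM := (@differentiable_transitions_manifold R n M).

Lemma mulmx_row_inj m (A B : 'M[R]_(n, m)) :
  (forall w : V, w *m A = w *m B) -> A = B.
Proof. by move=> AB; apply/row_matrixP => i; rewrite !rowE. Qed.

Lemma comp_in_linear c x : linear (fun v : tvec x => comp_in c v).
Proof. by move=> a u v; exact: linearP. Qed.

Lemma vec_of_linear c x : linear (fun w : V => vec_of c x w).
Proof. by move=> a u v; exact: linearP. Qed.

(** Matrices act on row vectors on the right, so this is the transpose of the
    usual matrix of xi. *)
Definition iso_mx c d x (xi : fib (B1 M) x) : 'M[R]_n :=
  lin1_mx (fun w => comp_in d (xi (vec_of c x w))).

Lemma mul_iso_mx c d x (xi : fib (B1 M) x) (w : V) :
  w *m iso_mx c d xi = comp_in d (xi (vec_of c x w)).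
Proof.
pose f (w : V) : V := comp_in d (xi (vec_of c x w)).
have fl : linear f.
  by move=> a u v; rewrite /f vec_of_linear (imap_linear xi) comp_in_linear.
pose L : {linear V -> V} := HB.pack f (GRing.isLinear.Build _ _ _ _ f fl).
by rewrite /iso_mx -/f -[f]/(L : V -> V) mul_rV_lin1.
Qed.

Lemma iso_mx_change c c' d d' x (xi : fib (B1 M) x) :
  matlas c -> matlas c' -> matlas d -> matlas d' ->
  cdom c x -> cdom c' x -> cdom d (tgt (B1 M) xi) -> cdom d' (tgt (B1 M) xi) ->
  iso_mx c d xi = 'J (cmap c' \o cinv c) (cmap c x) *m iso_mx c' d' xi
    *m 'J (cmap d \o cinv d') (cmap d' (tgt (B1 M) xi)).
Proof.
move=> Ac Ac' Ad Ad' cx c'x dt d't; apply: mulmx_row_inj => w.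
rewrite (mul_iso_mx c d xi w) !mulmxA.
rewrite -(diff_jacobian (cmap c' \o cinv c) (cmap c x) w).
rewrite (mul_iso_mx c' d' xi ('d (cmap c' \o cinv c) (cmap c x) w)).
rewrite -(diff_jacobian (cmap d \o cinv d')).
rewrite (comp_in_comp_in CM DM _ Ad' Ad d't dt).
rewrite -(comp_in_vec_of CM DM w Ac Ac' cx c'x).
by rewrite (comp_inK CM DM _ Ac' c'x).
Qed.

(** The analogue of [chart_diff] for a section of a groupoid: its target stays
    in the domain of d, and its coordinates are differentiable. *)
Definition section_diff (G : gpd M) (b : gsection G) c d y :=
  (\forall e \near cmap c y, cdom d (base_map b (cinv c e))) /\
  differentiable (sect_coord b c d) (cmap c y).

Lemma smooth_section_diff (G : gpd M) (b : gsection G) y :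
  smooth_section_at b y ->
  section_diff b (chart_at y) (chart_at (base_map b y)) y.
Proof.
case=> O [oO Oy _ Od Osm]; split; last exact: smooth_on_diff Osm Oy.
by apply: filterS Od _; exact: open_nbhs_nbhs.
Qed.

Lemma section_diff_base (G : gpd M) (b : gsection G) c d y :
  section_diff b c d y -> chart_diff c d (base_map b) y.
Proof.
case=> nd /differentiableP /is_diff_lsubmx H; split => //.
have <- : (fun e => lsubmx (sect_coord b c d e)) = cmap d \o base_map b \o cinv c.
  by apply/funext => e; rewrite row_mxKl.
exact: (ex_diff (is_diff_def := H)).
Qed.

Lemma sect_coord_change b c c' d d' e (x := cinv c e) :
  matlas c -> matlas c' -> matlas d -> matlas d' -> cmap c x = e ->
  cdom c x -> cdom c' x -> cdom d (base_map b x) -> cdom d' (base_map b x) ->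
  sect_coord b c d e = row_mx (cmap d (base_map b x))
    (mxvec ('J (cmap c' \o cinv c) e *m
      vec_mx (rsubmx (sect_coord b c' d' (cmap c' x))) *m
      'J (cmap d \o cinv d') (cmap d' (base_map b x)))).
Proof.
move=> Ac Ac' Ad Ad' ce cx c'x dt d't; rewrite /sect_coord (cmapK CM Ac' c'x).
rewrite row_mxKr; congr row_mx.
rewrite [LHS](congr1 mxvec
  (@iso_mx_change c c' d d' x (b x) Ac Ac' Ad Ad' cx c'x dt d't)).
by rewrite ce mxvecK.
Qed.

(** A local bisection is assumed smooth in the preferred charts of a point and
    of its image only; the transformation rule of the matrices of the
    isomorphisms, which involves the Jacobian matrices of the transitions,
    gives differentiability in all charts. *)
Lemma section_diff_change b c c' d d' y :
  matlas c -> matlas c' -> matlas d -> matlas d' ->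
  cdom c y -> cdom c' y -> cdom d (base_map b y) ->
  section_diff b c' d' y -> section_diff b c d y.
Proof.
move=> Ac Ac' Ad Ad' cy c'y dy sd.
have [nd' dS] := sd.
have bd' := section_diff_base sd.
have [[nd dbase] _] := chart_diff_change CM DM CM DM Ac Ac' Ad Ad' cy c'y dy bd'.
have d'y := chart_diff_mem CM Ac' c'y bd'.
have [[nd'c dbase'] _] :=
  chart_diff_change CM DM CM DM Ac Ac' Ad' Ad' cy c'y d'y bd'.
split=> //.
have d1 := differentiableP dbase.
have d2 := is_diff_id (cmap c y).
have [dJ d3] := is_diff_jacobian d2 (fun v => diff_transition2 v Ac Ac' cy c'y).
have d4 := differentiableP (DM Ac Ac' cy c'y).
have d5 : is_diff ((cmap c' \o cinv c) (cmap c y)) (sect_coord b c' d')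
    ('d (sect_coord b c' d') (cmap c' y)).
  by rewrite /= (cmapK CM Ac cy); exact: differentiableP.
have d6 := is_diff_vec_mx (is_diff_rsubmx (is_diff_comp d4 d5)).
have d7 := differentiableP dbase'.
have t2 v : differentiable (fun e => 'd (cmap d \o cinv d') e v)
    ((cmap d' \o base_map b \o cinv c) (cmap c y)).
  by rewrite /= (cmapK CM Ac cy); exact: diff_transition2.
have [dJ' d8] := is_diff_jacobian d7 t2.
have dd := is_diff_row_mx d1 (is_diff_mxvec (is_diff_mulmx (is_diff_mulmx d3 d6) d8)).
suff nE : \forall e \near cmap c y, row_mx (cmap d (base_map b (cinv c e)))
    (mxvec ('J (cmap c' \o cinv c) e *m
      vec_mx (rsubmx (sect_coord b c' d' (cmap c' (cinv c e)))) *m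
      'J (cmap d \o cinv d') (cmap d' (base_map b (cinv c e))))) =
    sect_coord b c d e.
  exact: (ex_diff (is_diff_def := is_diff_near_eq nE dd)).
near=> e.
have [ce c'e eE] : [/\ cdom c (cinv c e), cdom c' (cinv c e) & cmap c (cinv c e) = e].
  by near: e; exact: (near_overlap CM).
have de : cdom d (base_map b (cinv c e)) by near: e.
have d'e : cdom d' (base_map b (cinv c e)) by near: e.
by rewrite (sect_coord_change Ac Ac' Ad Ad' eE ce c'e de d'e).
Unshelve. all: by end_near. Qed.

Lemma act_B1_chart b c d (u Q : V) : matlas c -> matlas d ->
  cdom c (cinv c u) -> cmap c (cinv c u) = u ->
  cmap (tchart d) (act_B1 b (cinv (tchart c) (u, Q))) =
  (lsubmx (sect_coord b c d u), Q *m vec_mx (rsubmx (sect_coord b c d u))).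
Proof.
move=> Ac Ad cu uE; rewrite /sect_coord row_mxKl row_mxKr.
have -> : Q *m vec_mx (fcoord (B1 M) c d (b (cinv c u))) =
    Q *m iso_mx c d (b (cinv c u)) by congr (_ *m _); exact: mxvecK.
by rewrite mul_iso_mx /vec_of uE.
Qed.

(** In charts the action is (u, Q) |-> (b^0(u), Q A(u)), bilinear in Q and
    A(u). *)
Lemma is_diff_act_B1 b c d y (Q : V) : matlas c -> matlas d -> cdom c y ->
  section_diff b c d y ->
  is_diff ((cmap c y, Q) : V * V)
    (cmap (tchart d) \o act_B1 b \o cinv (tchart c))
    (fun w => (lsubmx (w.1 *m 'J (sect_coord b c d) (cmap c y)),
      w.2 *m iso_mx c d (b y) +
      Q *m vec_mx (rsubmx (w.1 *m 'J (sect_coord b c d) (cmap c y))))).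
Proof.
move=> Ac Ad cy [nd dS].
have d1 := is_diff_fst (is_diff_id ((cmap c y, Q) : V * V)).
have d2 := is_diff_snd (is_diff_id ((cmap c y, Q) : V * V)).
have dS' : is_diff ((cmap c y, Q).1 : V) (sect_coord b c d)
   (fun v => v *m 'J (sect_coord b c d) (cmap c y)).
  by apply: is_diff_ext (differentiableP dS) _ _ => // v; rewrite diff_jacobian.
have dd := is_diff_pair (is_diff_lsubmx (is_diff_comp d1 dS'))
  (is_diff_mulmx d2 (is_diff_vec_mx (is_diff_rsubmx (is_diff_comp d1 dS')))).
have nE : \forall z \near ((cmap c y, Q) : V * V),
   (lsubmx (sect_coord b c d z.1), z.2 *m vec_mx (rsubmx (sect_coord b c d z.1))) =
    (cmap (tchart d) \o act_B1 b \o cinv (tchart c)) z.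
  have := is_diff_near (is_diff_fst (is_diff_id ((cmap c y, Q) : V * V)))
    (near_overlap CM Ac Ac cy cy).
  by apply: filterS => -[u Q'] [cu _ uE]; exact: esym (act_B1_chart b Q' Ac Ad cu uE).
apply: is_diff_ext (is_diff_near_eq nE dd) _ _ => // w.
congr (_, _ + _); rewrite /= /sect_coord (cmapK CM Ac cy) row_mxKr.
by congr (_ *m _); exact: mxvecK.
Qed.

End SectionsB1.

(** * Jets acting on iterated tangent bundles *)

(** A jet has for coordinates its target, the matrix of its linear part, and
    the Jacobian matrix of a representative. *)
Definition jet_dim (n : nat) := (n + (n * n + n * (n + n * n)))%N.

Section JetAction.
Context {R : realType} {n : nat} {M : manifold R n}.
Notation V := 'rV[R]_n.
Implicit Types (c d : chart V M) (p x y : M).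
Local Notation ttchart c := (tchart (N := TB M) (tchart c)).
Local Notation CM := (compatible_manifold M).
Local Notation DM := (@differentiable_transitions_manifold R n M).
Local Notation CTM := (compatible_TM M).
Local Notation DTM := (@differentiable_transitions_TM R n M).
Local Notation CTTM := (compatible_TTM M).

Lemma jrep_class (G : gpd M) x (j : jet G x) :
  bdom (jrep j) x /\ jclass j = jet_class x (jrep j).
Proof. exact: (projT2 (cid (jclassP j))). Qed.

Lemma jrep_section_diff (j : forall x, fib (B11 M) x) c d y :
  matlas c -> matlas d -> cdom c y -> cdom d (tgt (B11 M) (j y)) ->
  section_diff (jrep (j y)) c d y.
Proof.
move=> Ac Ad cy dy; have [by_ _] := jrep_class (j y).
have [_ bsm _ _] := bisectionP (jrep (j y)).
apply: (section_diff_change Ac _ Ad _ cy _ dy (smooth_section_diff (bsm y by_))).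
- exact: mchart_atlas.
- exact: mchart_atlas.
- exact: mem_mchart.
Qed.

(** The representative chosen in the jet of b need not be b, but it has the
    same value and the same first derivatives. *)
Lemma jet_of_same_jet (G : gpd M) (b : bisection G) x (bx : bdom b x) :
  let b' := jrep (jet_of bx) in
  [/\ bdom b' x, b x = b' x &
   let c := chart_at x in let d := chart_at (base_map b x) in
   'J (sect_coord b c d) (cmap c x) = 'J (sect_coord b' c d) (cmap c x)].
Proof.
move=> b'; have [b'x E] : bdom b' x /\ jet_class x b = jet_class x b'.
  exact: jrep_class (jet_of bx).
clearbody b'.
have [_ [bE JE]] : jet_class x b b'.
  by rewrite E; exact: (conj b'x (conj erefl erefl)).
by split.
Qed.

(** The tangent map of (u, Q) |-> (b^0(u), Q A(u)), written with the
    coordinates T of the jet: in the row (v J) the first n entries are the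
    derivative of the base map along v and the others the derivative of the
    linear part. *)
Definition jet_action (T : 'rV[R]_(jet_dim n)) (z : (V * V) * (V * V)) :
    (V * V) * (V * V) :=
  let A : 'M[R]_n := vec_mx (lsubmx (rsubmx T)) in
  let J : 'M[R]_(n, n + n * n) := vec_mx (rsubmx (rsubmx T)) in
  ((lsubmx T, z.1.2 *m A),
   (lsubmx (z.2.1 *m J), z.2.2 *m A + z.1.2 *m vec_mx (rsubmx (z.2.1 *m J)))).

Definition jet_coord c d y (j : fib (B11 M) y) : 'rV[R]_(jet_dim n) :=
  row_mx (cmap d (tgt (B11 M) j))
    (row_mx (mxvec (iso_mx c d (jrep j y)))
            (mxvec ('J (sect_coord (jrep j) c d) (cmap c y)))).

(** The chosen representative of the jet is differentiable in the charts c and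
    d, and its action depends on its jet only. *)
Lemma act_B11_chart (j : forall y, fib (B11 M) y) c d (W : TB (TB M)) :
  matlas c -> matlas d -> cdom c W.1.1 -> cdom d (tgt (B11 M) (j W.1.1)) ->
  cmap (ttchart d) (act_B11 (j W.1.1) W) =
  jet_action (jet_coord c d (j W.1.1)) (cmap (ttchart c) W).
Proof.
case: W => -[y v] w /= Ac Ad cy dy.
have sd := jrep_section_diff Ac Ad cy dy.
set b := jrep (j y) in sd *.
have Atc : (@tchart R V M @` @matlas R n M) (tchart c) by exists c.
have Atd : (@tchart R V M @` @matlas R n M) (tchart d) by exists d.
have dF := is_diff_act_B1 (comp_in c (v : tvec y)) Ac Ad cy sd.
have cd : @chart_diff R _ _ (TB M) (TB M) (tchart c) (tchart d) (act_B1 b) (y, v).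
  split; last exact: (ex_diff (is_diff_def := dF)).
  exact: (is_diff_near (is_diff_fst (is_diff_id
    ((cmap c y, comp_in c (v : tvec y)) : V * V))) sd.1).
apply: etrans (tmap_chart CTM DTM CTM DTM (c := tchart c) (d := tchart d)
  (X := ((y, v), w)) Atc Atd cy cd) _.
rewrite [X in (_, X)](congr1 (fun k => k _) (diff_val (is_diff_def := dF))).
congr (_, _).
  rewrite /jet_coord row_mxKl row_mxKr row_mxKl mxvecK; congr (_, _).
  by rewrite mul_iso_mx (comp_inK CM DM).
by rewrite /jet_coord !row_mxKr !row_mxKl !mxvecK.
Qed.

Lemma sect_coord_B11 (j : gsection (B11 M)) c d e :
  sect_coord j c d e = jet_coord c d (j (cinv c e)).
Proof. by []. Qed.

(** The product rule applied to [jet_action], along a curve of jets with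
    velocity dT. *)
Definition diff_jet_action (T dT : 'rV[R]_(jet_dim n)) (z w : (V * V) * (V * V)) :
    (V * V) * (V * V) :=
  let A : 'M[R]_n := vec_mx (lsubmx (rsubmx T)) in
  let J : 'M[R]_(n, n + n * n) := vec_mx (rsubmx (rsubmx T)) in
  let dA : 'M[R]_n := vec_mx (lsubmx (rsubmx dT)) in
  let dJ : 'M[R]_(n, n + n * n) := vec_mx (rsubmx (rsubmx dT)) in
  ((lsubmx dT, w.1.2 *m A + z.1.2 *m dA),
   (lsubmx (w.2.1 *m J + z.2.1 *m dJ),
    (w.2.2 *m A + z.2.2 *m dA) +
    (w.1.2 *m vec_mx (rsubmx (z.2.1 *m J)) +
     z.1.2 *m vec_mx (rsubmx (w.2.1 *m J + z.2.1 *m dJ))))).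

Lemma is_diff_jet_action (S dS : V -> 'rV[R]_(jet_dim n)) (z : (V * V) * (V * V)) :
  is_diff (z.1.1 : V) S dS ->
  is_diff z (fun w : (V * V) * (V * V) => jet_action (S w.1.1) w)
    (fun w : (V * V) * (V * V) => diff_jet_action (S z.1.1) (dS w.1.1) z w).
Proof.
move=> dSz.
have d0 := is_diff_id z.
have d1 := is_diff_fst d0; have d2 := is_diff_snd d0.
have d11 := is_diff_fst d1; have d12 := is_diff_snd d1.
have d21 := is_diff_fst d2; have d22 := is_diff_snd d2.
have dT := is_diff_comp d11 dSz.
have dr := is_diff_rsubmx dT.
have dA := is_diff_vec_mx (is_diff_lsubmx dr).
have dJ := is_diff_vec_mx (is_diff_rsubmx dr).
have dRJ := is_diff_mulmx d21 dJ.
exact: (is_diff_pair (is_diff_pair (is_diff_lsubmx dT) (is_diff_mulmx d12 dA))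
  (is_diff_pair (is_diff_lsubmx dRJ)
    (is_diffD (is_diff_mulmx d22 dA)
       (is_diff_mulmx d12 (is_diff_vec_mx (is_diff_rsubmx dRJ)))))).
Qed.

Lemma ttchart_chart_at x (Q A B : V) :
  cmap (ttchart (chart_at x)) ((x, Q), (A, B)) =
  ((cmap (chart_at x) x, Q), (A, B)).
Proof.
apply: etrans (tchart_chart_at CTM (X := ((x, Q), (A, B)) : TB (TB M))
  (p := (x, Q)) erefl) _.
congr (_, _).
exact: (tchart_chart_at CM (X := (x, Q) : TB M) (p := x) erefl).
Qed.

Lemma ttchart_chart_at_inv x (Q A B : V) :
  cinv (ttchart (chart_at x)) ((cmap (chart_at x) x, Q), (A, B)) =
  ((x, Q), (A, B)).
Proof.
rewrite -(ttchart_chart_at x Q A B); apply: (cmapK CTTM).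
  exists (tchart (chart_at x)) => //; exists (chart_at x) => //.
  exact: mchart_atlas.
exact: mem_mchart.
Qed.

(** Over points near the base point of W the jets b(u) have unrelated
    representatives, but by [act_B11_chart] their actions are given in one
    chart by a single formula in their coordinates, which can then be
    differentiated. *)
Lemma tmap_act_sec_B11 (b : gsection (B11 M)) (W : TB (TB (TB M)))
    (c := chart_at W.1.1.1) (d := chart_at (base_map b W.1.1.1))
    (z := cmap (ttchart c) W.1) :
  smooth_section_at b W.1.1.1 ->
  tmap (act_sec_B11 b) W = (act_sec_B11 b W.1,
    diff_jet_action (sect_coord b c d z.1.1)
      (W.2.1.1 *m 'J (sect_coord b c d) z.1.1) z W.2).
Proof.
move=> bsm; have [nd dS] := smooth_section_diff bsm.
rewrite -/c -/d in nd dS.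
have Ac : matlas c by exact: mchart_atlas.
have Ad : matlas d by exact: mchart_atlas.
have cx : cdom c W.1.1.1 by exact: mem_mchart.
have dj := is_diff_jet_action (differentiableP (dS : differentiable _ z.1.1)).
congr (_, _).
have nE : \forall w \near z, jet_action (sect_coord b c d w.1.1) w =
    (cmap (ttchart d) \o act_sec_B11 b \o cinv (ttchart c)) w.
  have Attc : (@tchart R _ (TB M) @` (@tchart R V M @` @matlas R n M)) (ttchart c).
    by exists (tchart c) => //; exists c.
  have n1 := near_overlap CTTM (p := W.1) Attc Attc cx cx.
  have n2 := is_diff_near (is_diff_fst (is_diff_fst (is_diff_id z))) nd.
  near=> w.
  have [cw _ wE] : [/\ cdom (ttchart c) (cinv (ttchart c) w),
     cdom (ttchart c) (cinv (ttchart c) w) &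
     cmap (ttchart c) (cinv (ttchart c) w) = w] by near: w.
  have dw : cdom d (base_map b (cinv c w.1.1)) by near: w.
  apply: esym; apply: etrans (act_B11_chart (W := cinv (ttchart c) w) Ac Ad cw dw) _.
  by rewrite wE.
have E := congr1 (fun k => k W.2) (diff_val (is_diff_def := is_diff_near_eq nE dj)).
apply: etrans E _; by rewrite /= diff_jacobian.
Unshelve. all: by end_near. Qed.

Lemma tmap_act_sec_B11_at (b : gsection (B11 M)) x (d := chart_at (base_map b x))
    (c := chart_at x) (Q A B U : V) (W : V * (V * V)) :
  smooth_section_at b x ->
  tmap (act_sec_B11 b) ((((x, Q), (A, B)), ((U, W.1), W.2)) : TB (TB (TB M))) =
  (act_B11 (b x) ((x, Q), (A, B)),
   diff_jet_action (sect_coord b c d (cmap c x))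
     ('d (sect_coord b c d) (cmap c x) U) ((cmap c x, Q), (A, B))
     ((U, W.1), W.2)).
Proof.
move=> bsm; pose W' : TB (TB (TB M)) := (((x, Q), (A, B)), ((U, W.1), W.2)).
apply: etrans (tmap_act_sec_B11 (W := W') bsm) _.
apply: (f_equal2 pair) => //.
rewrite diff_jacobian -(ttchart_chart_at x Q A B).
by [].
Qed.

End JetAction.

(** * Symmetry jets in coordinates *)

Section Bilinear.
Context {R : realType} {n : nat}.
Notation V := 'rV[R]_n.

(** The bilinear map whose coefficients are the rows of G, each read as an n x
    n matrix. *)
Definition bil (G : 'M[R]_(n, n * n)) (v w : V) : V := w *m vec_mx (v *m G).

Lemma bilNl G v w : bil G (- v) w = - bil G v w.
Proof. by rewrite /bil mulNmx linearN mulmxN. Qed.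

Lemma bilNr G v w : bil G v (- w) = - bil G v w.
Proof. by rewrite /bil mulNmx. Qed.

Lemma bilDr G v w w' : bil G v (w + w') = bil G v w + bil G v w'.
Proof. by rewrite /bil mulmxDl. Qed.

Lemma bilZr G v a w : bil G v (a *: w) = a *: bil G v w.
Proof. by rewrite /bil scalemxAl. Qed.

Lemma bilBl G v v' w : bil G (v - v') w = bil G v w - bil G v' w.
Proof. by rewrite /bil mulmxBl linearB mulmxBr. Qed.

Lemma bilNG G v w : bil (- G) v w = - bil G v w.
Proof. by rewrite /bil mulmxN linearN mulmxN. Qed.

End Bilinear.

Section SymmetryJet.
Context {R : realType} {n : nat} {M : manifold R n} (s : symmetry_jet M).
Notation V := 'rV[R]_n.
Implicit Types (c d : chart V M) (p x y : M).
Local Notation ttchart c := (tchart (N := TB M) (tchart c)).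
Local Notation CM := (compatible_manifold M).
Local Notation DM := (@differentiable_transitions_manifold R n M).
Local Notation CTTM := (compatible_TTM M).

(** The target of a jet is the target of its linear part. *)
Lemma base_sj y : base_map (G := B11 M) s y = y.
Proof. by rewrite -[RHS]/(tgt (B1 M) (minus_id y)) -(sj_p s y). Qed.

Lemma base_jrep_sj y : base_map (G := B1 M) (jrep (s y)) y = y.
Proof. exact: base_sj. Qed.

Lemma iso_mx_minus_id c y : matlas c -> cdom c y ->
  iso_mx c c (minus_id y) = - 1%:M.
Proof.
move=> Ac cy; apply: mulmx_row_inj => w.
rewrite mul_iso_mx mulmxN mulmx1.
transitivity (- comp_in c (vec_of c y w)); last by rewrite (vec_ofK CM DM).
exact: linearN.
Qed.

Lemma iso_mx_sj c y : matlas c -> cdom c y ->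
  iso_mx c c (jrep (s y) y) = - 1%:M.
Proof.
move=> Ac cy; rewrite -(iso_mx_minus_id Ac cy) -(sj_p s y).
by [].
Qed.

Lemma section_diff_sj c y : matlas c -> cdom c y ->
  section_diff (jrep (s y)) c c y.
Proof.
by move=> Ac cy; apply: jrep_section_diff => //; rewrite [tgt _ _]base_sj.
Qed.

(** The derivative of the linear part of the jet s(y), as a map from vectors
    to flattened matrices. *)
Definition sj2 c y : 'M[R]_(n, n * n) :=
  @rsubmx R n n (n * n) ('J (sect_coord (jrep (s y)) c c) (cmap c y)).

(** Semiholonomy: the derivative of the base map is the linear part of the
    jet, that is -1. *)
Lemma jacobian_sj c y : matlas c -> cdom c y ->
  'J (sect_coord (jrep (s y)) c c) (cmap c y) = row_mx (- 1%:M) (sj2 c y).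
Proof.
move=> Ac cy; have sd := section_diff_sj Ac cy.
set J := 'J _ _; rewrite -[LHS](@hsubmxK _ n n (n * n) J); congr row_mx.
apply: mulmx_row_inj => w; rewrite mulmxN mulmx1.
have bd := section_diff_base sd.
have fE : (fun e => lsubmx (sect_coord (jrep (s y)) c c e)) =
    cmap c \o base_map (jrep (s y)) \o cinv c.
  by apply/funext => e; rewrite row_mxKl.
have := tmap_chart CM DM CM DM (X := (y, vec_of c y w)) Ac Ac cy bd.
move=> /(congr1 snd) /= E.
have -> : w *m lsubmx J = 'd (cmap c \o base_map (jrep (s y)) \o cinv c) (cmap c y) w.
  have dl := is_diff_lsubmx (differentiableP sd.2).
  rewrite fE in dl; rewrite (diff_val (is_diff_def := dl)) diff_jacobian.
  by rewrite -/J mulmx_lsub.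
rewrite -[in LHS](vec_ofK CM DM w Ac cy); apply: etrans (esym E) _.
have semi : (tmap (base_map (jrep (s y))) ((y, vec_of c y w) : TB M)).2 =
    jet_p (s y) (vec_of c y w).
  exact: esym (@sj_semiholonomic R n M s y (vec_of c y w)).
apply: etrans (congr1 (comp_in (x := base_map (jrep (s y)) y) c) semi) _.
transitivity (comp_in c (minus_id y (vec_of c y w))).
  by rewrite -(sj_p s y).
transitivity (- comp_in c (vec_of c y w)); last by rewrite (vec_ofK CM DM).
exact: linearN.
Qed.

Lemma jet_coord_sj c y : matlas c -> cdom c y ->
  jet_coord c c (s y) =
  row_mx (cmap c y) (row_mx (mxvec (- 1%:M)) (mxvec (row_mx (- 1%:M) (sj2 c y)))).
Proof.
move=> Ac cy; rewrite /jet_coord [tgt _ _]base_sj iso_mx_sj // jacobian_sj //.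
Qed.

Definition sj2_coord c (e : V) : 'M[R]_(n, n * n) := sj2 c (cinv c e).

(** All coordinates of s but the second order ones are constant, or those of
    the base point. *)
Lemma near_sect_coord_sj c x : matlas c -> cdom c x ->
  \forall e \near cmap c x, sect_coord s c c e =
    row_mx e (row_mx (mxvec (- 1%:M)) (mxvec (row_mx (- 1%:M) (sj2_coord c e)))).
Proof.
move=> Ac cx; apply: filterS (near_overlap CM Ac Ac cx cx) => e [ce _ eE].
by rewrite sect_coord_B11 jet_coord_sj // eE.
Qed.

Lemma differentiable_sj2 x (c := chart_at x) :
  differentiable (sj2_coord c) (cmap c x).
Proof.
have Ac : matlas c by exact: mchart_atlas.
have cx : cdom c x by exact: mem_mchart.
have [_ dS] := smooth_section_diff (sj_smooth s x).
rewrite base_sj -/c in dS.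
have dG := is_diff_rsubmx (is_diff_vec_mx (is_diff_rsubmx (is_diff_rsubmx
  (differentiableP (dS : differentiable (sect_coord s c c : V -> 'rV_(jet_dim n)) _))))).
suff nE : \forall e \near cmap c x,
    @rsubmx _ n n (n * n) (vec_mx (rsubmx (rsubmx
      (sect_coord s c c e : 'rV_(jet_dim n))))) = sj2_coord c e.
  exact: (ex_diff (is_diff_def := is_diff_near_eq nE dG)).
apply: filterS (near_sect_coord_sj Ac cx) => e ->.
by rewrite !row_mxKr mxvecK row_mxKr.
Qed.

Local Notation dsj2 x v :=
  ('d (sj2_coord (chart_at x)) (cmap (chart_at x) x) v).

Lemma is_diff_sect_coord_sj x (c := chart_at x) :
  is_diff (cmap c x) (sect_coord s c c)
    (fun v => row_mx v (row_mx 0 (mxvec (row_mx 0 (dsj2 x v))))).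
Proof.
have Ac : matlas c by exact: mchart_atlas.
have cx : cdom c x by exact: mem_mchart.
have dG := differentiableP (differentiable_sj2 x).
have dS := is_diff_row_mx (is_diff_id (cmap c x))
  (is_diff_row_mx (is_diff_cst (mxvec (- 1%:M : 'M[R]_n)) (cmap c x))
     (is_diff_mxvec (is_diff_row_mx (is_diff_cst (- 1%:M : 'M[R]_n) (cmap c x)) dG))).
apply: is_diff_near_eq dS.
by apply: filterS (near_sect_coord_sj Ac cx) => e ->.
Qed.

Lemma jet_action_sj_coord (e Q A B : V) (G : 'M[R]_(n, n * n)) :
  jet_action (row_mx e (row_mx (mxvec (- 1%:M)) (mxvec (row_mx (- 1%:M) G))))
    ((e, Q), (A, B)) = ((e, - Q), (- A, bil G A Q - B)).
Proof.
rewrite /jet_action !row_mxKr !row_mxKl !mxvecK /=.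
by rewrite mul_mx_row row_mxKl row_mxKr !mulmxN !mulmx1 [- B + _]addrC.
Qed.

Lemma jet_action_sj x (c := chart_at x) (Q A B : V) :
  act_B11 (s x) ((x, Q), (A, B)) = ((x, - Q), (- A, bil (sj2 (chart_at x) x) A Q - B)).
Proof.
have Ac : matlas c by exact: mchart_atlas.
have cx : cdom c x by exact: mem_mchart.
set W := act_B11 _ _.
have W1 : W.1.1 = x by exact: base_sj.
have cW1 : cdom c W.1.1 by rewrite W1.
have Attc : (@tchart R _ (TB M) @` (@tchart R _ M @` @matlas R n M)) (ttchart c).
  by exists (tchart c) => //; exists c.
have dW : cdom c (tgt (B11 M) (s x)) by rewrite [tgt _ _]base_sj.
have E : cmap (ttchart c) W = _ :=
  act_B11_chart (W := ((x, Q), (A, B)) : TB (TB M)) Ac Ac cx dW.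
rewrite -[LHS](cmapK CTTM Attc (p := W) cW1) E.
rewrite [cmap _ _]ttchart_chart_at [jet_coord _ _ _](jet_coord_sj Ac cx).
by rewrite jet_action_sj_coord [LHS]ttchart_chart_at_inv.
Qed.

(** Differentiates (e, Q, A, B) |-> (e, -Q, -A, G_e(A, Q) - B) along (U, Q',
    A', B'); the chosen representative of the jet of s acts in the same way
    because its coordinates have the same value and derivative at x. *)
Lemma act_B111_j1s x (Q A B U Q' A' B' : V)
    (G := sj2 (chart_at x) x) :
  act_B111 (j1s s x) ((((x, Q), (A, B)), ((U, Q'), (A', B'))) : TB (TB (TB M))) =
  (((x, - Q), (- A, bil (sj2 (chart_at x) x) A Q - B)),
   ((U, - Q'), (- A', bil G A Q' + (bil G A' Q + bil (dsj2 x U) A Q) - B'))).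
Proof.
have Ac : matlas (chart_at x) by exact: mchart_atlas.
have cx : cdom (chart_at x) x by exact: mem_mchart.
have [bx bE JE] := jet_of_same_jet (b := sj_bisection s) (x := x) I.
rewrite /act_B111; set b := jrep (j1s s x).
have bE' : b x = s x by exact: esym bE.
have [_ bsm _ _] := bisectionP b.
have bbase : base_map b x = x by rewrite /base_map bE'; exact: base_sj.
have JE' : 'J (sect_coord b (chart_at x) (chart_at x)) (cmap (chart_at x) x) =
   'J (sect_coord s (chart_at x) (chart_at x)) (cmap (chart_at x) x).
  have sb : base_map (sj_bisection s) x = x := base_sj x.
  by move: JE; cbv zeta; rewrite sb => JE; exact: (esym JE).
apply: etrans (tmap_act_sec_B11_at Q A B U (Q', (A', B')) (bsm x bx)) _.
apply: (f_equal2 pair); first by rewrite bE'; exact: jet_action_sj.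
rewrite bbase.
have -> : 'd (sect_coord b (chart_at x) (chart_at x)) (cmap (chart_at x) x) U =
    row_mx U (row_mx 0 (mxvec (row_mx 0 (dsj2 x U)))).
  apply: etrans (diff_jacobian _ _ _) _; rewrite JE'.
  apply: etrans (esym (diff_jacobian _ _ _)) _.
  by rewrite (diff_val (is_diff_def := is_diff_sect_coord_sj x)).
have -> : sect_coord b (chart_at x) (chart_at x) (cmap (chart_at x) x) =
    row_mx (cmap (chart_at x) x)
      (row_mx (mxvec (- 1%:M)) (mxvec (row_mx (- 1%:M) G))).
  rewrite sect_coord_B11 (cmapK CM Ac cx).
  apply: etrans (jet_coord_sj Ac cx).
  by rewrite bE'.
rewrite /diff_jet_action !row_mxKr !row_mxKl !mxvecK.
rewrite !mul_mx_row !add_row_mx !row_mxKl !row_mxKr !mulmxN !mulmx1 /=.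
by rewrite /bil -mulmxDr -linearD !linear0 !addr0 [- B' + _]addrC.
Qed.

Lemma tttchart_chart_at x (Q A B U Q' A' B' : V) :
  cmap (tchart (N := TB (TB M)) (ttchart (chart_at x)))
    ((((x, Q), (A, B)), ((U, Q'), (A', B'))) : TB (TB (TB M))) =
   (((cmap (chart_at x) x, Q), (A, B)), ((U, Q'), (A', B'))).
Proof.
apply: etrans (tchart_chart_at CTTM (X := (((x, Q), (A, B)), ((U, Q'), (A', B'))))
  (p := ((x, Q), (A, B))) erefl) _.
by apply: (f_equal2 pair) => //; exact: ttchart_chart_at.
Qed.

(** The involution of the second tangent bundle of N = TM, the elements of N
    being pairs (x, Q): it exchanges (A, B) and (U, Q'). *)
Lemma kappa_at x (Q A B U Q' A' B' : V) :
  kappa (N := TB M) ((((x, Q), (A, B)), ((U, Q'), (A', B'))) : TB (TB (TB M))) =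
  (((x, Q), (U, Q')), ((A, B), (A', B'))).
Proof.
apply: etrans (tchart_chart_at_inv CTTM ((x, Q), (U, Q'))
  ((A, B), (A', B'))).
rewrite [kappa _](congr1 (fun e : ((V * V) * (V * V)) * ((V * V) * (V * V)) =>
  cinv (tchart (N := TB (TB M)) (ttchart (chart_at x)))
    ((e.1.1, e.2.1), (e.1.2, e.2.2)))
  (tttchart_chart_at x Q A B U Q' A' B')).
congr (cinv _ _); apply: (f_equal2 pair) => //.
by apply: esym; exact: ttchart_chart_at.
Qed.

End SymmetryJet.

(** * The commutator on the third tangent bundle *)

Section RightHandSide.
Context {R : realType} {n : nat} {M : manifold R n}.
Notation V := 'rV[R]_n.
Implicit Types (c d : chart V M) (p x y : M).
Local Notation ttchart c := (tchart (N := TB M) (tchart c)).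
Local Notation CM := (compatible_manifold M).
Local Notation DM := (@differentiable_transitions_manifold R n M).
Local Notation CTM := (compatible_TM M).
Local Notation DTM := (@differentiable_transitions_TM R n M).
Local Notation CTTM := (compatible_TTM M).

Lemma is_diff_TBproj (E : normedModType R) (N : charted E) (A : set (chart E N))
    (c : chart E N) (X : TB N) : compatible A -> A c -> cdom c X.1 ->
  is_diff (cmap (tchart c) X : E * E) (cmap c \o @TBproj R E N \o cinv (tchart c)) fst.
Proof.
move=> CA Ac cX; have d1 := is_diff_fst (is_diff_id (cmap (tchart c) X : E * E)).
have := is_diff_near d1 (near_overlap CA Ac Ac cX cX).
move=> nE; apply: is_diff_near_eq d1; move: nE.
by apply: filterS => e [_ _ eE]; exact: esym eE.
Qed.

(** In induced charts the projections are linear. *)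
Lemma tmap_TBproj_chart c (W : TB (TB M)) : matlas c -> cdom c W.1.1 ->
  cmap (tchart c) (tmap (@TBproj R _ M) W) =
  ((cmap (ttchart c) W).1.1, (cmap (ttchart c) W).2.1).
Proof.
move=> Ac cW.
have Atc : (@tchart R V M @` @matlas R n M) (tchart c) by exists c.
have dp := is_diff_TBproj CM Ac cW.
have cd : @chart_diff R _ _ (TB M) M (tchart c) c (@TBproj R _ M) W.1.
  split; last exact: (ex_diff (is_diff_def := dp)).
  have := near_overlap CTM Atc Atc (p := W.1) cW cW.
  by apply: filterS => e [].
apply: etrans (tmap_chart CTM DTM CM DM (X := W) Atc Ac cW cd) _.
by rewrite (diff_val (is_diff_def := dp)).
Qed.

(** In charts, the last component is dropped by the three projections. *)
Lemma same_projections_at x (Q A B U Q' A' B1 B2 : V) :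
  same_projections (M := M) (((x, Q), (A, B)), ((U, Q'), (A', B1)))
    (((x, Q), (A, B)), ((U, Q'), (A', B2))).
Proof.
have Ac : matlas (chart_at x) by exact: mchart_atlas.
have cx : cdom (chart_at x) x by exact: mem_mchart.
have Atc : (@tchart R V M @` @matlas R n M) (tchart (chart_at x)).
  by exists (chart_at x).
have Attc : (@tchart R _ (TB M) @` (@tchart R _ M @` @matlas R n M))
    (ttchart (chart_at x)).
  by exists (tchart (chart_at x)).
split=> //.
  apply: (f_equal2 pair) => //.
  have dp := is_diff_TBproj (N := TB M) CTM (c := tchart (chart_at x))
    (X := ((x, Q), (A, B)) : TB (TB M)) Atc cx.
  have E := diff_val (is_diff_def := dp).
  have F B' := congr1 (fun k => k ((U, Q'), (A', B'))) E.
  exact: etrans (F B1) (esym (F B2)).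
apply: (f_equal2 pair) => //.
pose P : TB (TB M) := ((x, Q), (A, B)).
pose e0 : (V * V) * (V * V) := cmap (ttchart (chart_at x)) P.
have d0 := is_diff_id e0.
have dp := is_diff_pair (is_diff_fst (is_diff_fst d0)) (is_diff_fst (is_diff_snd d0)).
have nE : \forall e \near e0, (e.1.1, e.2.1) =
  (cmap (tchart (chart_at x)) \o tmap (@TBproj R _ M) \o cinv (ttchart (chart_at x))) e.
  have := near_overlap CTTM Attc Attc (p := P) cx cx.
  apply: filterS => e [ce _ eE]; apply: esym.
  by apply: etrans (tmap_TBproj_chart Ac ce) _; rewrite eE.
have E := diff_val (is_diff_def := is_diff_near_eq nE dp).
have F B' := congr1 (fun k => k ((U, Q'), (A', B'))) E.
exact: etrans (F B1) (esym (F B2)).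
Qed.

Lemma Pi_at x (Q A B U Q' A' B1 B2 : V) :
  Pi (M := M) (((x, Q), (A, B)), ((U, Q'), (A', B1)))
    (((x, Q), (A, B)), ((U, Q'), (A', B2))) = B1 - B2.
Proof.
rewrite /Pi; case: pselect => [sp|]; last by case; exact: same_projections_at.
congr (_ - _).
  exact: (congr1 (fun e => e.2.2.2) (tttchart_chart_at x Q A B U Q' A' B1)).
exact: (congr1 (fun e => e.2.2.2) (tttchart_chart_at x Q A B U Q' A' B2)).
Qed.

(** Both composites send (Q, A, U) to (Q, -A, -U) and agree on the next two
    components; in the last one the terms in B, Q', A' and B' occur with equal
    signs and disappear from the difference. *)
Lemma Pi_commutator (s : symmetry_jet M) x (Q A B U Q' A' B' : V)
    (G := sj2 s (chart_at x) x)
    (D := fun v : V => 'd (sj2_coord s (chart_at x)) (cmap (chart_at x) x) v)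
    (W := (((x, Q), (A, B)), ((U, Q'), (A', B'))) : TB (TB (TB M))) :
  Pi (kappa_act (j1s s x) (act_B111 (j1s s x) W))
     (act_B111 (j1s s x) (kappa_act (j1s s x) W)) =
  (bil (D A) U Q - bil (D U) A Q) *+ 2 + bil G U (bil G A Q) - bil G A (bil G U Q).
Proof.
pose k1 := bil G U (bil G A Q - B) + (bil G A' Q - bil (D (- A)) U Q)
  - (bil G A Q' + (bil G A' Q + bil (D U) A Q) - B').
pose k2 := bil G A (bil G U Q - Q') + (bil G A' Q - bil (D (- U)) A Q)
  - (bil G U B + (bil G A' Q + bil (D A) U Q) - B').
have -> : kappa_act (j1s s x) (act_B111 (j1s s x) W) =
    (((x, Q), (- A, B - bil G A Q)), ((- U, Q' - bil G U Q), (A', k1))).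
  rewrite /W /kappa_act !(act_B111_j1s, kappa_at) -/G /k1.
  by rewrite !(bilNr, bilNl) ?opprK opprB [- _ + Q']addrC.
have -> : act_B111 (j1s s x) (kappa_act (j1s s x) W) =
    (((x, Q), (- A, B - bil G A Q)), ((- U, Q' - bil G U Q), (A', k2))).
  rewrite /W /kappa_act !(act_B111_j1s, kappa_at) -/G /k2.
  by rewrite !(bilNr, bilNl) ?opprK opprB [- _ + B]addrC.
rewrite [LHS]Pi_at /k1 /k2 /D !linearN !bilNG !opprK !bilDr !bilNr -/(D _).
set t1 := bil _ _ _; set t2 := bil _ _ _; set t3 := bil _ _ _.
set t4 := bil _ _ _; set t5 := bil _ _ _; set t6 := bil _ _ _.
by apply/rowP => j; rewrite !mxE; ring.
Qed.

(** Smoothness is assumed for the section y |-> (y, Z y) of the tangent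
    bundle; the components of Z are its second projection. *)
Lemma near_vf_coord_diff (Z : vector_field M) x (c := chart_at x) :
  \forall e \near cmap c x, differentiable (vf_coord Z c) e /\
    forall v, differentiable (fun e => 'd (vf_coord Z c) e v) e.
Proof.
have [ O [oO Ox _ _ Osm]] := vf_smooth Z x.
pose F (e : V) : V * V := (cmap c (cinv c e), vf_coord Z c e).
have dF1 e : O e -> differentiable F e by exact: smooth_on_diff.
have dZ1 e : O e -> is_diff e (vf_coord Z c) (fun v => ('d F e v).2).
  by move=> /dF1 /differentiableP dFe; exact: (is_diff_snd dFe).
have nO : \forall e \near cmap c x, O e by exact: open_nbhs_nbhs.
apply: filterS nO => e Oe; split.
  by have dZe := dZ1 e Oe; exact: ex_diff.
move=> v.
have d2 : differentiable (fun e => 'd F e v) e := smooth_on_diff2 v Osm Oe.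
have d2s := is_diff_snd (differentiableP d2).
suff nE : \forall e' \near e, ('d F e' v).2 = 'd (vf_coord Z c) e' v.
  exact: (ex_diff (is_diff_def := is_diff_near_eq nE d2s)).
have nOe : \forall e' \near e, O e' by exact: open_nbhs_nbhs.
apply: filterS nOe => e' Oe'.
by rewrite (diff_val (is_diff_def := dZ1 e' Oe')).
Qed.

Lemma is_diff_vf_section (Z : vfield M) c x : matlas c -> cdom c x ->
  differentiable (vf_coord Z c) (cmap c x) ->
  is_diff (cmap c x) (cmap (tchart c) \o (fun y => (y, Z y) : TB M) \o cinv c)
    (fun v => (v, 'd (vf_coord Z c) (cmap c x) v)).
Proof.
move=> Ac cx dZ1.
apply: is_diff_near_eq (is_diff_pair (is_diff_id (cmap c x)) (differentiableP dZ1)).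
apply: filterS (near_overlap CM Ac Ac cx cx) => e [_ _ eE].
by apply: (f_equal2 pair) => //; exact: esym eE.
Qed.

Lemma tmap_vf (Z : vector_field M) x (v : V) :
  tmap (fun y => (y, Z y) : TB M) ((x, v) : TB M) =
  ((x, Z x), (v, 'd (vf_coord Z (chart_at x)) (cmap (chart_at x) x) v)).
Proof.
have Ac : matlas (chart_at x) by exact: mchart_atlas.
have cx : cdom (chart_at x) x by exact: mem_mchart.
have [dZ1 _] := nbhs_singleton (near_vf_coord_diff Z x).
apply: (f_equal2 pair) => //.
exact: (congr1 (fun k => k v)
  (diff_val (is_diff_def := is_diff_vf_section Ac cx dZ1))).
Qed.

(** The second derivatives of Z are confined to the components left
    existential, which cancel in [Pi_commutator]. *)
Lemma tmap_tmap_vf (Z : vector_field M) x (Q v w : V) : exists Q' A' B' : V,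
  tmap (tmap (fun y => (y, Z y) : TB M)) (((x, Q), (v, w)) : TB (TB M)) =
  (((x, Z x), (Q, 'd (vf_coord Z (chart_at x)) (cmap (chart_at x) x) Q)),
   ((v, Q'), (A', B'))).
Proof.
set c := chart_at x; pose F : M -> TB M := fun y => (y, Z y).
have Ac : matlas c by exact: mchart_atlas.
have cx : cdom c x by exact: mem_mchart.
have Atc : (@tchart R V M @` @matlas R n M) (tchart c) by exists c.
set z0 : V * V := cmap (tchart c) ((x, Q) : TB M).
have nZ := near_vf_coord_diff Z x; rewrite -/c in nZ.
have [dZ1 dZ2] := nbhs_singleton nZ.
have d0 := is_diff_id z0.
have d1 := is_diff_fst d0; have d2 := is_diff_snd d0.
have [dJ d3] := is_diff_jacobian d1 dZ2.
have d4 := is_diff_comp d1 (differentiableP (dZ1 : differentiable _ z0.1)).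
have dd := is_diff_pair (is_diff_pair d1 d4) (is_diff_pair d2 (is_diff_mulmx d2 d3)).
have nE : \forall z \near z0, (((z : V * V).1, vf_coord Z c z.1),
      (z.2, z.2 *m 'J (vf_coord Z c) z.1)) =
   (cmap (ttchart c) \o tmap F \o cinv (tchart c)) z.
  have n1 := near_overlap CTM (p := (x, Q)) Atc Atc cx cx.
  have n2 := is_diff_near d1 nZ.
  have n3 := is_diff_near d1 (near_overlap CM Ac Ac cx cx).
  near=> z.
  have [cz _ zE] : [/\ cdom (tchart c) (cinv (tchart c) z),
    cdom (tchart c) (cinv (tchart c) z) &
    cmap (tchart c) (cinv (tchart c) z) = z] by near: z.
  have [dz _] : differentiable (vf_coord Z c) z.1 /\
    forall v, differentiable (fun e => 'd (vf_coord Z c) e v) z.1 by near: z.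
  have [_ _ z1E] : [/\ cdom c (cinv c z.1), cdom c (cinv c z.1) &
    cmap c (cinv c z.1) = z.1] by near: z.
  have {}dz : differentiable (vf_coord Z c) (cmap c (cinv c z.1)) by rewrite z1E.
  have dF1 := is_diff_vf_section Ac cz dz.
  have cd : @chart_diff R _ _ M (TB M) c (tchart c) F (cinv (tchart c) z).1.
    split; last exact: (ex_diff (is_diff_def := dF1)).
    by apply: filterS (near_overlap CM Ac Ac cz cz) => e [].
  apply: esym; apply: etrans (tmap_chart CM DM CTM DTM (F := F)
    (X := cinv (tchart c) z) Ac Atc cz cd) _.
  rewrite (diff_val (is_diff_def := dF1)).
  have -> : comp_in c ((cinv (tchart c) z).2 : tvec (cinv (tchart c) z).1) = z.2.
    exact: (congr1 snd zE).
  rewrite -diff_jacobian; apply: (f_equal2 pair).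
    by apply: (f_equal2 pair) => //; exact: z1E.
  by rewrite [cmap c _]z1E.
have E := congr1 (fun k => k (v, w)) (diff_val (is_diff_def := is_diff_near_eq nE dd)).
do 3 eexists; apply: (f_equal2 pair); first exact: tmap_vf.
exact: E.
Unshelve. all: by end_near. Qed.

End RightHandSide.

(** * The connection and its curvature in coordinates *)

Section Connection.
Context {R : realType} {n : nat} {M : manifold R n}.
Notation V := 'rV[R]_n.
Implicit Types (c d : chart V M) (p x y : M).
Local Notation CM := (compatible_manifold M).
Local Notation DM := (@differentiable_transitions_manifold R n M).

Lemma vf_coord_cmap (X : vfield M) c y : matlas c -> cdom c y ->
  vf_coord X c (cmap c y) = comp_in c (X y).
Proof. by move=> Ac cy; rewrite /vf_coord (cmapK CM Ac cy). Qed.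

Lemma vf_coord_change (X : vfield M) c c' y : matlas c -> matlas c' ->
  cdom c y -> cdom c' y ->
  comp_in c' (X y) =
  vf_coord X c (cmap c y) *m 'J (cmap c' \o cinv c) (cmap c y).
Proof.
move=> Ac Ac' cy c'y; rewrite -diff_jacobian vf_coord_cmap //.
by rewrite (comp_in_comp_in CM DM).
Qed.

(** In general the bracket at y is a difference of two derivatives, and
    changing charts needs the symmetry of the second derivatives of the
    transitions. Where U vanishes the second term is zero, and so is the
    contribution of the derivative of the Jacobian matrix in the product rule.
    *)
Lemma lie_vanishing (Y U : vfield M) c y dU : matlas c -> cdom c y ->
  (U y : V) = 0 -> is_diff (cmap c y) (vf_coord U c) dU ->
  comp_in c (lie Y U y) = dU (comp_in c (Y y)).
Proof.
move=> Ac cy U0 dUc; set c' := chart_at y.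
have Ac' : matlas c' by exact: mchart_atlas.
have c'y : cdom c' y by exact: mem_mchart.
have d1 := differentiableP (DM Ac' Ac c'y cy).
have d2 : is_diff ((cmap c \o cinv c') (cmap c' y)) (vf_coord U c) dU.
  by rewrite /= (cmapK CM Ac' c'y).
have t2 v : differentiable (fun e => 'd (cmap c' \o cinv c) e v)
    ((cmap c \o cinv c') (cmap c' y)).
  by rewrite /= (cmapK CM Ac' c'y); exact: diff_transition2.
have [dJ d3] := is_diff_jacobian d1 t2.
(* the components transform by the Jacobian matrix of the transition *)
have nE : \forall e \near cmap c' y,
    (vf_coord U c \o (cmap c \o cinv c')) e *m
      'J (cmap c' \o cinv c) ((cmap c \o cinv c') e) = vf_coord U c' e.
  apply: filterS (near_overlap CM Ac' Ac c'y cy) => e [c'e ce _].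
  by rewrite [RHS](vf_coord_change U Ac Ac' ce c'e).
have dU' := is_diff_near_eq nE (is_diff_mulmx (is_diff_comp d1 d2) d3).
have lE : lie Y U y = 'd (vf_coord U c') (cmap c' y) (Y y).
  have Y1 : vf_coord Y c' (cmap c' y) = Y y.
    by apply: etrans (vf_coord_cmap Y Ac' c'y) _; exact: (comp_in_chart_at CM).
  have U1 : vf_coord U c' (cmap c' y) = 0.
    apply: etrans (vf_coord_cmap U Ac' c'y) _.
    by rewrite (comp_in_chart_at CM (U y)).
  have aux (f g : {linear V -> V}) (a b : V) : b = 0 -> f a - g b = f a.
    by move=> ->; rewrite linear0 subr0.
  by rewrite -[in RHS]Y1; exact: (aux _ _ _ _ U1).
rewrite lE (diff_val (is_diff_def := dU')).
have -> : (vf_coord U c \o (cmap c \o cinv c')) (cmap c' y) = 0.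
  rewrite /= (cmapK CM Ac' c'y) vf_coord_cmap //.
  apply: etrans (congr1 (comp_in (x := y) c) U0) _.
  exact: etrans (diff_jacobian _ _ _) (mul0mx _ _).
rewrite mul0mx addr0 /= (cmapK CM Ac' c'y) -diff_jacobian.
rewrite /comp_in -/c' (diff_transition_comp CM DM) //.
exact: (diff_transition_id CM _ Ac cy).
Qed.

Lemma comp_in_eq c p q (v : V) : p = q ->
  comp_in (x := p) c v = comp_in (x := q) c v.
Proof. by move=> ->. Qed.

(** The pushed field is defined by a choice of a preimage under the base map;
    on the image of the bisection the left inverse of the base map tells which
    one is chosen. *)
Lemma bisection_inverse (b : bisection (B1 M)) c y : matlas c -> cdom c y ->
  bdom b y -> base_map b y = y ->
  exists g : M -> M,
    [/\ g y = y, chart_diff c c g y &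
     \forall e \near cmap c y, forall Z : vfield M, let p := cinv c e in
       base_map b (g p) = p /\ (push b Z p : V) = b (g p) (Z (g p))].
Proof.
move=> Ac cy by_ byE; have [_ _ bop [g [gK gsm]]] := bisectionP b.
have gy : g y = y by rewrite -[X in g X]byE gK.
have iy : (base_map b @` bdom b) y by exists y.
exists g; split=> //.
  have [ O [oO Oy _ Od Osm]] := gsm y iy.
  have cd : chart_diff (chart_at y) (chart_at (g y)) g y.
    split; last exact: smooth_on_diff Osm Oy.
    by apply: filterS Od _; exact: open_nbhs_nbhs.
  have cgy : cdom c (g y) by rewrite gy.
  have [] // := chart_diff_change CM DM CM DM Ac (mchart_atlas y) Ac
    (mchart_atlas (g y)) cy (mem_mchart y) cgy cd.
apply: filterS (near_cinv Ac cy bop iy) => e ie Z.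
set p := cinv c e in ie *; have [q bq qE] := ie.
have gq : g p = q by rewrite -qE gK.
split; first by rewrite gq.
rewrite /push; case: pselect => [h|[]]; last by case: ie => r br rE; exists r.
case: (cid h) => r [br rE] /=.
by have -> : r = g p by rewrite -rE gK.
Qed.

Lemma sect_coord_iso_mx (b : gsection (B1 M)) c d q : matlas c -> cdom c q ->
  vec_mx (rsubmx (sect_coord b c d (cmap c q))) = iso_mx c d (b q).
Proof.
by move=> Ac cq; rewrite /sect_coord row_mxKr (cmapK CM Ac cq); exact: mxvecK.
Qed.

Context (s : symmetry_jet M).

(** The linear part of s(y) is -1. *)
Lemma push_sj_at (Z : vfield M) y :
  (push (jrep (s y)) Z y : V) = - (Z y : V).
Proof.
have [by_ _] := jrep_class (s y).
have [g [gy _ /nbhs_singleton /(_ Z)]] :=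
  bisection_inverse (mchart_atlas y) (mem_mchart y) by_ (base_jrep_sj s y).
rewrite (mchartK (mchart_atlas y) (mem_mchart y)) gy => -[_ ->].
transitivity (minus_id y (Z y)) => //.
by rewrite -(sj_p s y).
Qed.

(** In charts the pushed field is e |-> Z(h e) A(h e), where h is the inverse
    of the base map. As dh = -1 and A = -1 at y, the first term of the product
    rule gives back DZ, and the second one gives the second order part of s(y)
    with a minus sign. *)
Lemma is_diff_push_sj (Z : vfield M) c y : matlas c -> cdom c y ->
  differentiable (vf_coord Z c) (cmap c y) ->
  is_diff (cmap c y) (vf_coord (push (jrep (s y)) Z) c)
   (fun v => 'd (vf_coord Z c) (cmap c y) v - bil (sj2 s c y) v (comp_in c (Z y))).
Proof.
move=> Ac cy dZ; set b := jrep (s y).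
have [by_ _] := jrep_class (s y); rewrite -/b in by_.
have [g [gy [gn gd] pE]] := bisection_inverse Ac cy by_ (base_jrep_sj s y).
have [_ dS] := section_diff_sj s Ac cy; rewrite -/b in dS.
set S := sect_coord b c c in dS.
pose h := cmap c \o g \o cinv c.
have h0 : h (cmap c y) = cmap c y by rewrite /h /= (cmapK CM Ac cy) gy.
have dh := differentiableP (gd : differentiable h _).
have dSh : is_diff (h (cmap c y)) S ('d S (cmap c y)).
  by rewrite h0; exact: differentiableP.
have dSE v : 'd S (cmap c y) v = row_mx (- v) (v *m sj2 s c y).
  by rewrite diff_jacobian (jacobian_sj s Ac cy) mul_mx_row mulmxN mulmx1.
have nh : \forall e \near cmap c y,
    [/\ cinv c (h e) = g (cinv c e), cmap c (cinv c e) = e &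
     cdom c (cinv c e)].
  near=> e; have [ce _ eE] : [/\ cdom c (cinv c e), cdom c (cinv c e) &
    cmap c (cinv c e) = e] by near: e; exact: (near_overlap CM).
  split=> //; apply: (cmapK CM Ac).
  by near: e.
have bgE : \forall e \near cmap c y, base_map b (g (cinv c e)) = cinv c e.
  by apply: filterS pE => e /(_ Z)[].
(* h is a local inverse of the base map, whose differential is -1 *)
have hE v : 'd h (cmap c y) v = - v.
  have dS1 := is_diff_lsubmx (is_diff_comp dh dSh).
  have nE : \forall e \near cmap c y, lsubmx ((S \o h) e) = e.
    near=> e; have [hE eE ce] : [/\ cinv c (h e) = g (cinv c e),
      cmap c (cinv c e) = e & cdom c (cinv c e)] by near: e.
    have bE : base_map b (g (cinv c e)) = cinv c e by near: e.
    by rewrite row_mxKl hE bE.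
  have dS2 := is_diff_near_eq nE dS1.
  have E : v = lsubmx ('d S (cmap c y) ('d h (cmap c y) v)) := etrans
    (esym (congr1 (fun k => k v) (diff_val (is_diff_def := is_diff_id (cmap c y)))))
    (congr1 (fun k => k v) (diff_val (is_diff_def := dS2))).
  by rewrite [in RHS]E dSE row_mxKl opprK.
have dZh : is_diff (h (cmap c y)) (vf_coord Z c) ('d (vf_coord Z c) (cmap c y)).
  by rewrite h0; exact: differentiableP.
have dd := is_diff_mulmx (is_diff_comp dh dZh)
  (is_diff_vec_mx (is_diff_rsubmx (is_diff_comp dh dSh))).
have nE : \forall e \near cmap c y,
    (vf_coord Z c \o h) e *m vec_mx (rsubmx ((S \o h) e)) =
    vf_coord (push b Z) c e.
  near=> e.
  have cq : cdom c (g (cinv c e)) by near: e.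
  have [bE bZ] : base_map b (g (cinv c e)) = cinv c e /\
    (push b Z (cinv c e) : V) = b (g (cinv c e)) (Z (g (cinv c e))).
    by near: e; apply: filterS pE => e /(_ Z).
  rewrite [RHS](congr1 (comp_in (x := cinv c e) c) bZ) -[RHS](comp_in_eq c _ bE).
  rewrite [vec_mx _](sect_coord_iso_mx b c Ac cq).
  rewrite [(_ \o _) e](vf_coord_cmap Z Ac cq) mul_iso_mx.
  by rewrite (comp_inK CM DM).
apply: is_diff_ext (is_diff_near_eq nE dd) _ _ => // v.
have A1 : vec_mx (rsubmx (S (h (cmap c y)))) = - 1%:M.
  by rewrite h0 [vec_mx _](sect_coord_iso_mx b c Ac cy) (iso_mx_sj s Ac cy).
have A2 : vf_coord Z c (h (cmap c y)) = comp_in c (Z y).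
  by rewrite h0; exact: vf_coord_cmap.
have A3 : rsubmx ('d S (cmap c y) ('d h (cmap c y) v)) = (- v) *m sj2 s c y.
  by rewrite hE dSE row_mxKr.
have A0 : 'd (vf_coord Z c) (cmap c y) ('d h (cmap c y) v) =
    - 'd (vf_coord Z c) (cmap c y) v.
  apply: etrans (congr1 ('d (vf_coord Z c) (cmap c y)) (hE v)) _.
  by rewrite !diff_jacobian mulNmx.
apply: etrans (f_equal2 +%R (f_equal2 mulmx A0 A1)
  (f_equal2 mulmx A2 (congr1 vec_mx A3))) _.
by rewrite mulmxN mulmx1 opprK -bilNl.
Unshelve. all: by end_near. Qed.

Lemma nabla_chart (Y Z : vfield M) c y : matlas c -> cdom c y ->
  differentiable (vf_coord Z c) (cmap c y) ->
  comp_in c (nabla s Y Z y) = 'd (vf_coord Z c) (cmap c y) (comp_in c (Y y))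
    - 2^-1 *: bil (sj2 s c y) (comp_in c (Y y)) (comp_in c (Z y)).
Proof.
move=> Ac cy dZ; pose U : vfield M := fun p => Z p + push (jrep (s y)) Z p.
have U0 : (U y : V) = 0 by rewrite /U push_sj_at subrr.
have dU : is_diff (cmap c y) (vf_coord U c) (fun v => 'd (vf_coord Z c) (cmap c y) v +
    ('d (vf_coord Z c) (cmap c y) v - bil (sj2 s c y) v (comp_in c (Z y)))).
  have := is_diffD (differentiableP dZ) (is_diff_push_sj Ac cy dZ).
  move=> /is_diff_ext; apply=> // e.
  by rewrite /vf_coord /U; apply: esym; exact: linearD.
have L := lie_vanishing Y Ac cy U0 dU.
have -> : comp_in c (nabla s Y Z y) = 2^-1 *: comp_in c (lie Y U y) by exact: linearZ.
rewrite L addrA scalerBr; congr (_ - _).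
by rewrite -mulr2n -[X in _ *: X]scaler_nat scalerA mulVf ?scale1r ?pnatr_eq0.
Qed.

Lemma diff_bil_expand (y z dy dz m a b : V) (J : 'M[R]_n)
    (G dG : 'M[R]_(n, n * n)) : m = a -> dy *m J = b ->
  dy *m J + m - 2^-1 *: (dz *m vec_mx (y *m G) + z *m vec_mx (dy *m G + y *m dG)) =
  a + b - 2^-1 *: (bil dG y z + bil G dy z + bil G y dz).
Proof.
move=> -> ->; rewrite [b + a]addrC; congr (_ - _ *: _).
rewrite addrC linearD mulmxDr; congr (_ + _); exact: addrC.
Qed.

(** Differentiates the formula of [nabla_chart], which holds in one and the
    same chart at all points near x. *)
Lemma nabla_nabla (X : vfield M) (Y Z : vector_field M) x (c := chart_at x)
    (e := cmap c x) (G := sj2 s c x) :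
  nabla s X (nabla s Y Z) x =
  'd (fun e' => 'd (vf_coord Z c) e' (Y x)) e (X x) +
  'd (vf_coord Z c) e ('d (vf_coord Y c) e (X x))
  - 2^-1 *: (bil ('d (sj2_coord s c) e (X x)) (Y x) (Z x)
     + bil G ('d (vf_coord Y c) e (X x)) (Z x)
     + bil G (Y x) ('d (vf_coord Z c) e (X x)))
  - 2^-1 *: bil G (X x)
     ('d (vf_coord Z c) e (Y x) - 2^-1 *: bil G (Y x) (Z x)) :> V.
Proof.
have Ac : matlas c by exact: mchart_atlas.
have cx : cdom c x by exact: mem_mchart.
have comp_at (v : tvec x) : comp_in c v = v by exact: (comp_in_chart_at CM).
have nZ := near_vf_coord_diff Z x; have nY := near_vf_coord_diff Y x.
rewrite -/c in nZ nY.
have [dZ dZ2] := nbhs_singleton nZ; have [dY _] := nbhs_singleton nY.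
have d1 := differentiableP dZ; have d2 := differentiableP dY.
have d3 := differentiableP (differentiable_sj2 s x).
have [dJ d4] := is_diff_jacobian (is_diff_id e) dZ2.
have Y0 : vf_coord Y c e = Y x by rewrite (vf_coord_cmap Y Ac cx) comp_at.
have Z0 : vf_coord Z c e = Z x by rewrite (vf_coord_cmap Z Ac cx) comp_at.
have G0 : sj2_coord s c e = G by rewrite /sj2_coord (cmapK CM Ac cx).
have nZd : \forall e' \near e, differentiable (vf_coord Z c) e'.
  by apply: filterS nZ => e' [].
have nE : \forall e' \near e, vf_coord Y c e' *m 'J (vf_coord Z c) e' -
    2^-1 *: bil (sj2_coord s c e') (vf_coord Y c e') (vf_coord Z c e') =
    vf_coord (nabla s Y Z) c e'.
  near=> e'.
  have [ce _ eE] : [/\ cdom c (cinv c e'), cdom c (cinv c e') &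
    cmap c (cinv c e') = e'] by near: e'; exact: (near_overlap CM).
  have dZe : differentiable (vf_coord Z c) e' by near: e'.
  have dZe' : differentiable (vf_coord Z c) (cmap c (cinv c e')) by rewrite eE.
  by rewrite [RHS](nabla_chart Y Ac ce dZe') eE diff_jacobian.
have dbil := is_diff_mulmx d1 (is_diff_vec_mx (is_diff_mulmx d2 d3)).
have dd := is_diffB (is_diff_mulmx d2 d4) (is_diffZ (2^-1) dbil).
have dN := is_diff_near_eq nE dd.
have J2 : Y x *m dJ (X x) = 'd (fun e' => 'd (vf_coord Z c) e' (Y x)) e (X x).
  have dYJ := is_diff_mulmx (is_diff_cst (Y x : V) e) d4.
  have nE2 : \forall e' \near e, cst (Y x : V) e' *m 'J (vf_coord Z c) e' =
      'd (vf_coord Z c) e' (Y x).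
    by near=> e'; rewrite diff_jacobian.
  have E := congr1 (fun k => k (X x))
     (diff_val (is_diff_def := is_diff_near_eq nE2 dYJ)).
  by apply: esym; apply: etrans E _; rewrite /= mul0mx add0r.
have step : 'd (vf_coord Y c) e (X x) *m 'J (vf_coord Z c) e +
    vf_coord Y c e *m dJ (X x) - 2^-1 *:
    ('d (vf_coord Z c) e (X x) *m vec_mx (vf_coord Y c e *m sj2_coord s c e) +
     vf_coord Z c e *m vec_mx ('d (vf_coord Y c) e (X x) *m sj2_coord s c e +
       vf_coord Y c e *m 'd (sj2_coord s c) e (X x))) =
   'd (fun e' => 'd (vf_coord Z c) e' (Y x)) e (X x) +
   'd (vf_coord Z c) e ('d (vf_coord Y c) e (X x))
   - 2^-1 *: (bil ('d (sj2_coord s c) e (X x)) (Y x) (Z x)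
     + bil G ('d (vf_coord Y c) e (X x)) (Z x)
     + bil G (Y x) ('d (vf_coord Z c) e (X x))).
  rewrite Y0 Z0 G0; apply: (diff_bil_expand _ _ _ _ _ J2).
  exact: esym (diff_jacobian (vf_coord Z c) e _).
have LN := etrans (congr1 (fun k => k (X x)) (diff_val (is_diff_def := dN))) step.
have CX : comp_in c (X x) = X x := comp_at (X x).
have N0 : comp_in c (nabla s Y Z x) =
    'd (vf_coord Z c) e (Y x) - 2^-1 *: bil G (Y x) (Z x).
  apply: etrans (nabla_chart Y Ac cx dZ) _.
  have -> : comp_in c (Y x) = Y x := comp_at (Y x).
  by have -> : comp_in c (Z x) = Z x := comp_at (Z x).
apply: etrans (esym (comp_at (nabla s X (nabla s Y Z) x))) _.
apply: etrans (nabla_chart X Ac cx (ex_diff (is_diff_def := dN))) _.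
by rewrite CX N0; congr (_ - _); exact: LN.
Unshelve. all: by end_near. Qed.

Lemma nabla_at (X : vfield M) (Z : vector_field M) x (c := chart_at x)
    (e := cmap c x) :
  nabla s X Z x = 'd (vf_coord Z c) e (X x) - 2^-1 *: bil (sj2 s c x) (X x) (Z x) :> V.
Proof.
have Ac : matlas c by exact: mchart_atlas.
have cx : cdom c x by exact: mem_mchart.
have comp_at (v : tvec x) : comp_in c v = v by exact: (comp_in_chart_at CM).
have [dZ _] := nbhs_singleton (near_vf_coord_diff Z x).
apply: etrans (esym (comp_at (nabla s X Z x))) _.
apply: etrans (nabla_chart X Ac cx dZ) _.
have -> : comp_in c (X x) = X x := comp_at (X x).
by have -> : comp_in c (Z x) = Z x := comp_at (Z x).
Qed.

Lemma lie_at (X Y : vfield M) x (c := chart_at x) (e := cmap c x) :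
  lie X Y x = 'd (vf_coord Y c) e (X x) - 'd (vf_coord X c) e (Y x) :> V.
Proof.
have Ac : matlas c by exact: mchart_atlas.
have cx : cdom c x by exact: mem_mchart.
have at_ (W : vfield M) : vf_coord W c e = W x.
  apply: etrans (vf_coord_cmap W Ac cx) _; exact: (comp_in_chart_at CM).
by rewrite -[X x]at_ -[Y x]at_.
Qed.

Lemma curvature_algebra (D D' a b r1 r2 p1 p2 q1 q2 g1 g2 N1 N2 N3 : V) :
  D = D' ->
  N1 = D + a - 2^-1 *: (r1 + p1 + q1) - 2^-1 *: (q2 - 2^-1 *: g1) ->
  N2 = D' + b - 2^-1 *: (r2 + p2 + q2) - 2^-1 *: (q1 - 2^-1 *: g2) ->
  N3 = a - b - 2^-1 *: (p1 - p2) ->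
  N1 - N2 - N3 = 2^-1 *: (r2 - r1) + 4^-1 *: (g1 - g2).
Proof.
move=> -> -> -> ->; apply/rowP => j; by rewrite !mxE; field.
Qed.

(** In the alternating difference the second derivatives of Z cancel by
    symmetry, and the terms containing derivatives of X and Y cancel with the
    bracket. *)
Lemma curvature_at (X Y Z : vector_field M) x (c := chart_at x)
    (e := cmap c x) (G := sj2 s c x) (D := fun v : V => 'd (sj2_coord s c) e v) :
  curvature s X Y Z x =
  2^-1 *: (bil (D (Y x)) (X x) (Z x) - bil (D (X x)) (Y x) (Z x)) +
  4^-1 *: (bil G (X x) (bil G (Y x) (Z x)) - bil G (Y x) (bil G (X x) (Z x))) :> V.
Proof.
have sch : 'd (fun e' => 'd (vf_coord Z c) e' (Y x)) e (X x) =
    'd (fun e' => 'd (vf_coord Z c) e' (X x)) e (Y x).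
  have nZ := near_vf_coord_diff Z x.
  have [_ dZ2] := nbhs_singleton nZ.
  by apply: schwarz; [apply: filterS nZ => e' []|exact: dZ2|exact: dZ2].
have dB u v : 'd (vf_coord Z c) e (u - v) =
    'd (vf_coord Z c) e u - 'd (vf_coord Z c) e v.
  by rewrite !diff_jacobian mulmxBl.
have bE (u v w : V) :
    bil G u (v - 2^-1 *: w) = bil G u v - 2^-1 *: bil G u w.
  by rewrite bilDr bilNr bilZr.
have E4 := lie_at X Y x.
have E3 := etrans (nabla_at (lie X Y) Z x) (f_equal2 (fun a b : V => a - 2^-1 *: b)
  (etrans (congr1 ('d (vf_coord Z c) e) E4) (dB _ _))
  (etrans (congr1 (fun v : V => bil G v (Z x)) E4) (bilBl _ _ _ _))).
have E1 := etrans (nabla_nabla X Y Z x)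
  (congr1 (fun a : V => _ - 2^-1 *: a) (bE _ _ _)).
have E2 := etrans (nabla_nabla Y X Z x)
  (congr1 (fun a : V => _ - 2^-1 *: a) (bE _ _ _)).
exact: (curvature_algebra sch E1 E2 E3).
Qed.

End Connection.

Theorem theorem5p1 (R : realType) (n : nat) (M : manifold R n)
    (s : symmetry_jet M) (X Y Z : vector_field M) (x : M) :
  let XX : TB (TB (TB M)) := tmap (tmap (fun y => (y, Z y) : TB M))
              (tmap (fun y => (y, Y y) : TB M) ((x, X x) : TB M)) in
  curvature s X Y Z x =
    4^-1 *: Pi (kappa_act (j1s s x) (act_B111 (j1s s x) XX))
               (act_B111 (j1s s x) (kappa_act (j1s s x) XX)).
Proof.
move=> XX; rewrite /XX tmap_vf.
have [Q' [A' [B' ->]]] := tmap_tmap_vf Z x (Y x) (X x)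
  ('d (vf_coord Y (chart_at x)) (cmap (chart_at x) x) (X x)).
apply: etrans (curvature_at s X Y Z x) _.
rewrite Pi_commutator.
set p := bil _ _ _; set q := bil _ _ _; set g1 := bil _ _ _; set g2 := bil _ _ _.
by apply/rowP => j; rewrite !mxE; field.
Qed.
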